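(* Let $\Omega\subseteq\mathbb{C}^n$ be a bounded, convex, homogeneous, $d$-balanced domain and let $D\subseteq\mathbb{C}^n$ be a bounded domain. Then the $d$-balanced squeezing function $S^{\Omega}_{d,D}:D\to(0,1]$ is continuous.
   Context: Let $n\geq 2$ and let $d=(d_1,\dots,d_n)$ be an $n$-tuple of positive integers. A domain $\Omega\subseteq\mathbb{C}^n$ is $d$-balanced if for each $z=(z_1,\dots,z_n)\in\Omega$ and each $\lambda\in\mathbb{C}$ with $|\lambda|\leq 1$ one has $(\lambda^{d_1}z_1,\dots,\lambda^{d_n}z_n)\in\Omega$. Its $d$-Minkowski function is $h_{d,\Omega}(z):=\inf\{t>0:(z_1/t^{d_1},\dots,z_n/t^{d_n})\in\Omega\}$, $z\in\mathbb{C}^n$, and for $0<r\leq 1$ one sets $\Omega^d(r):=\{z\in\mathbb{C}^n:h_{d,\Omega}(z)<r\}$. A domain is homogeneous if its group of holomorphic automorphisms acts transitively on it. $\mathcal{O}_u(D,\Omega)$ denotes the set of injective holomorphic maps $D\to\Omega$. For a bounded domain $D\subseteq\mathbb{C}^n$ and a bounded, convex, $d$-balanced domain $\Omega\subseteq\mathbb{C}^n$, the $d$-balanced squeezing function of $D$ corresponding to $\Omega$ is $$S_{d,D}^{\Omega}(z):=\sup\{r\in(0,1]:\Omega^d(r)\subseteq f(D),\ f\in\mathcal{O}_u(D,\Omega),\ f(z)=0\},\quad z\in D.$$ *)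

(* Defs.v *)
(* Written with MathComp and MathComp-Analysis; C^n is 'rV[R[i]]_n for
   R : realType. *)
From HB Require Import structures.
From mathcomp Require Import all_boot all_order all_algebra.
From mathcomp Require Import complex.
From mathcomp Require Import all_classical all_reals all_analysis.

Set Implicit Arguments.
Unset Strict Implicit.
Unset Printing Implicit Defensive.

Import Order.TTheory GRing.Theory Num.Theory numFieldNormedType.Exports.

Local Open Scope classical_set_scope.
Local Open Scope ring_scope.
Local Open Scope complex_scope.

(* The library puts the topology of a numFieldType K on the alias K^o, and
   canonically only on abstract K; without this instance ['rV[R[i]]_n] would
   not be recognized as a topological space. *)
#[non_forgetful_inheritance]
HB.instance Definition _ (R : rcfType) := NormedModule.copy R[i] R[i]^o.

Section SqueezingFunction.
Context (R : realType) (n : nat).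
Notation Cn := 'rV[R[i]]_n.
Implicit Types (D Omega : set Cn) (d : 'I_n -> nat) (f : Cn -> Cn).

Definition is_domain D : Prop := [/\ D !=set0, open D & connected D].

(* [differentiable] is taken over the scalar field R[i], hence is complex
   (Frechet) differentiability; only the values of f on the open set D
   matter. *)
Definition holomorphic_on D f : Prop := forall z, D z -> differentiable f z.

Definition automorphism Omega f : Prop :=
  [/\ holomorphic_on Omega f, set_bij Omega Omega f &
      exists g : Cn -> Cn,
        [/\ holomorphic_on Omega g, set_fun Omega Omega g,
            forall z, Omega z -> g (f z) = z &
            forall z, Omega z -> f (g z) = z]].

Definition homogeneous Omega : Prop :=
  forall z w, Omega z -> Omega w -> exists2 f, automorphism Omega f & f z = w.

(* In R[i], 0 <= t <= 1 forces t to be real, so this is ordinary (real)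
   convexity although the scalars of the module Cn are complex. *)
Definition convex_in_Cn Omega : Prop := convex_set Omega.

Definition d_balanced d Omega : Prop :=
  forall (z : Cn) (lambda : R[i]), Omega z -> `|lambda| <= 1 ->
    Omega (\row_i (lambda ^+ d i * z 0 i)).

Definition d_minkowski d Omega (z : Cn) : R :=
  inf [set t : R | 0 < t /\ Omega (\row_i (z 0 i / t%:C ^+ d i))].

Definition d_sublevel d Omega (r : R) : set Cn :=
  [set z | d_minkowski d Omega z < r].

Definition injective_holomorphic D Omega : set (Cn -> Cn) :=
  [set f | [/\ holomorphic_on D f, set_fun D Omega f & set_inj D f]].

Definition squeezing d Omega D (z : Cn) : R :=
  sup [set r : R | 0 < r <= 1 /\
    exists f, [/\ injective_holomorphic D Omega f, f z = 0 &
                  d_sublevel d Omega r `<=` f @` D]].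

End SqueezingFunction.

(* Main.v *)
Require Import Defs.
From HB Require Import structures.
From mathcomp Require Import all_boot all_order all_algebra.
From mathcomp Require Import cyclic separable cyclotomic complex ring lra zify.
From mathcomp Require Import all_classical all_reals all_analysis.
Import Order.TTheory GRing.Theory Num.Theory numFieldNormedType.Exports.
Local Open Scope classical_set_scope.
Local Open Scope ring_scope.
Local Open Scope complex_scope.

Set Implicit Arguments.
Unset Strict Implicit.

(* If a is close to 0 there is an automorphism g of Omega, close to the
   identity, with g(a) = 0: for a_k -> 0 choose automorphisms f_k with
   f_k(a_k) = 0 by homogeneity; a limit F of the f_k along an ultrafilter is an
   automorphism fixing 0 (Cartan), and F^-1 o f_k maps a_k to 0 and tends to
   the identity. Composing a competitor f for the squeezing function at z with
   g for a = f(w) gives a competitor at w that loses at most epsilon, uniformly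
   for z, w near a given point, because competitors are uniformly Lipschitz
   there. That (s - epsilon)-sublevels are mapped into s-sublevels uses t^d x in Omega
   for x in the closure of Omega and t < 1.

   Since differentiability is only assumed pointwise, Cauchy's estimates are
   derived from a Goursat argument; it is run on Riemann sums over the
   boundaries of dyadic squares instead of integrals, and the constants are
   removed by taking powers. *)

(** An automorphism need not extend to the boundary of [Omega], while sublevels of radius near 1
    come close to it. Pointwise convergence to the identity inside [Omega] nevertheless suffices,
    because the points to control are [t^d x] with [x] in [Omega] and [t < 1 - epsilon], and these
    accumulate only inside [Omega]. What makes a pointwise limit of holomorphic maps holomorphic is
    a uniform bound on second-order Taylor remainders, since such a bound survives the limit. In one
    variable it amounts to bounding a divided difference of a divided difference. These quotients
    are not known to be differentiable at their base points, only bounded near them, so Cauchy's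
    inequality is needed for functions with two exceptional points. A factor with double zeros
    restores differentiability there. *)

(** * The complex modulus with values in [R] *)

Section ComplexModulus.
Context (R : realType).
Implicit Types (x y z : R[i]).

(* The order of R[i] is only partial; [cmod] and [rnorm] are the modulus and
   the norm as elements of R, so that estimates take place in an ordered
   field. *)
Definition cmod z : R := complex.Re `|z|.

Lemma cmodE z : `|z| = (cmod z)%:C.
Proof. by rewrite RRe_real // normr_real. Qed.

Lemma cmod_ge0 z : 0 <= cmod z.
Proof. by rewrite -lecR -cmodE normr_ge0. Qed.

Lemma cmod0 : cmod 0 = 0.
Proof. by apply: complexI; rewrite -cmodE normr0. Qed.

Lemma cmod_eq0 z : cmod z = 0 -> z = 0.
Proof. by move=> h; apply/normr0_eq0; rewrite cmodE h. Qed.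

Lemma cmod_gt0 z : (0 < cmod z) = (z != 0).
Proof.
rewrite lt_neqAle cmod_ge0 andbT eq_sym; apply/idP/idP.
  by apply: contra => /eqP ->; rewrite cmod0.
by apply: contra => /eqP /cmod_eq0 ->.
Qed.

Lemma cmodN z : cmod (- z) = cmod z.
Proof. by rewrite /cmod normrN. Qed.

Lemma cdistC x y : cmod (x - y) = cmod (y - x).
Proof. by rewrite -cmodN opprB. Qed.

Lemma ler_cmodD x y : cmod (x + y) <= cmod x + cmod y.
Proof. by rewrite -lecR rmorphD /= -!cmodE ler_normD. Qed.

Lemma ler_cmodB x y : cmod (x - y) <= cmod x + cmod y.
Proof. by rewrite -(cmodN y) ler_cmodD. Qed.

Lemma ler_cmod_sub x y : cmod x <= cmod (x - y) + cmod y.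
Proof. by have := ler_cmodD (x - y) y; rewrite subrK. Qed.

Lemma ler_cmod_sum (I : Type) (r : seq I) (P : pred I) (F : I -> R[i]) :
  cmod (\sum_(i <- r | P i) F i) <= \sum_(i <- r | P i) cmod (F i).
Proof.
elim/big_rec2: _ => [|i y x _ h]; first by rewrite cmod0.
by apply: le_trans (ler_cmodD _ _) _; rewrite lerD2l.
Qed.

Lemma cmodM x y : cmod (x * y) = cmod x * cmod y.
Proof. by apply: complexI; rewrite rmorphM /= -!cmodE normrM. Qed.

Lemma cmodX x n : cmod (x ^+ n) = cmod x ^+ n.
Proof. by apply: complexI; rewrite rmorphXn /= -!cmodE normrX. Qed.

Lemma cmodV x : cmod x^-1 = (cmod x)^-1.
Proof. by apply: complexI; rewrite fmorphV /= -!cmodE normfV. Qed.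

Lemma cmod_real (a : R) : cmod (a%:C) = `|a|.
Proof. by rewrite /cmod normc_def /= expr0n addr0 sqrtr_sqr. Qed.

Lemma cmod_nat k : cmod (k%:R : R[i]) = k%:R.
Proof. by rewrite -(rmorph_nat (real_complex R)) cmod_real ger0_norm. Qed.

Lemma cmodi : cmod 'i = 1.
Proof. by rewrite /cmod normc_def /= expr0n expr1n add0r sqrtr1. Qed.

Lemma cmod1 : cmod 1 = 1.
Proof. by rewrite (cmod_real 1) normr1. Qed.

Lemma ler_Re_cmod z : `|complex.Re z| <= cmod z.
Proof.
rewrite /cmod normc_def /= -[leLHS]sqrtr_sqr ler_wsqrtr //.
by rewrite lerDl sqr_ge0.
Qed.

Lemma ler_Im_cmod z : `|complex.Im z| <= cmod z.
Proof.
rewrite /cmod normc_def /= -[leLHS]sqrtr_sqr ler_wsqrtr //.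
by rewrite lerDr sqr_ge0.
Qed.

Lemma ler_cmod_ReIm z : cmod z <= `|complex.Re z| + `|complex.Im z|.
Proof.
rewrite [in leLHS](complexE z).
by apply: le_trans (ler_cmodD _ _) _; rewrite cmodM cmodi mul1r !cmod_real.
Qed.

End ComplexModulus.

(** * Norms, neighbourhoods and differentiability with real radii *)

Section RealNorm.
Context (R : realType).
Implicit Types (V W : normedModType R[i]).

Definition rnorm V (x : V) : R := complex.Re `|x|.

Lemma rnormE V (x : V) : `|x| = (rnorm x)%:C.
Proof. by rewrite RRe_real // normr_real. Qed.

Lemma rnorm_ge0 V (x : V) : 0 <= rnorm x.
Proof. by rewrite -lecR -rnormE normr_ge0. Qed.

Lemma rnorm0 V : rnorm (0 : V) = 0.
Proof. by apply: complexI; rewrite -rnormE normr0. Qed.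

Lemma rnorm_eq0 V (x : V) : rnorm x = 0 -> x = 0.
Proof. by move=> h; apply/normr0_eq0; rewrite rnormE h. Qed.

Lemma rnormN V (x : V) : rnorm (- x) = rnorm x.
Proof. by rewrite /rnorm normrN. Qed.

Lemma rdistC V (x y : V) : rnorm (x - y) = rnorm (y - x).
Proof. by rewrite -rnormN opprB. Qed.

Lemma ler_rnormD V (x y : V) : rnorm (x + y) <= rnorm x + rnorm y.
Proof. by rewrite -lecR rmorphD /= -!rnormE ler_normD. Qed.

Lemma ler_rnormB V (x y : V) : rnorm (x - y) <= rnorm x + rnorm y.
Proof. by rewrite -(rnormN y) ler_rnormD. Qed.

Lemma ler_rdistD V (z x y : V) : rnorm (x - y) <= rnorm (x - z) + rnorm (z - y).
Proof. by have := ler_rnormD (x - z) (z - y); rewrite addrA subrK. Qed.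

Lemma ler_rnorm_sub V (x y : V) : rnorm x <= rnorm (x - y) + rnorm y.
Proof. by have := ler_rnormD (x - y) y; rewrite subrK. Qed.

Lemma ler_rnorm_sum V (I : Type) (r : seq I) (P : pred I) (F : I -> V) :
  rnorm (\sum_(i <- r | P i) F i) <= \sum_(i <- r | P i) rnorm (F i).
Proof.
elim/big_rec2: _ => [|i y x _ h]; first by rewrite rnorm0.
by apply: le_trans (ler_rnormD _ _) _; rewrite lerD2l.
Qed.

Lemma rnormZ V (a : R[i]) (x : V) : rnorm (a *: x) = cmod a * rnorm x.
Proof. by apply: complexI; rewrite rmorphM /= -!rnormE -cmodE normrZ. Qed.

Lemma rnorm_gt0 V (x : V) : (0 < rnorm x) = (x != 0).
Proof.
rewrite lt_neqAle rnorm_ge0 andbT eq_sym; apply/idP/idP.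
  by apply: contra => /eqP ->; rewrite rnorm0.
by apply: contra => /eqP /rnorm_eq0 ->.
Qed.

Lemma rnorm_coord n (x : 'rV[R[i]]_n) i : cmod (x 0 i) <= rnorm x.
Proof.
rewrite -lecR -cmodE -rnormE [leRHS]mx_normE.
have -> : `|x 0 i| = (`|x 0 i|%:nng)%:num by [].
rewrite num_le.
by apply/bigmax_geP; right; exists (0, i).
Qed.

Lemma rnorm_coord_le n (x : 'rV[R[i]]_n) e :
  0 <= e -> (forall i, cmod (x 0 i) <= e) -> rnorm x <= e.
Proof.
move=> e0 H; have [x0|] := eqVneq (mx_norm x) 0.
  by rewrite (mx_norm_eq0 x0) rnorm0.
move=> /mx_norm_neq0[[j i]]; rewrite (ord1 j) /= => xi.
by move: (H i); rewrite /rnorm [`|x|]xi.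
Qed.

(** A positive element of [R[i]] has imaginary part 0, so balls of real radius form a neighbourhood
    base. *)
Lemma nbhs_rnormP V (x : V) (A : set V) :
  nbhs x A <-> exists2 e, 0 < e & forall y, rnorm (y - x) < e -> A y.
Proof.
split=> [/nbhs_ballP[e /= e0 xA]|[e e0 xA]].
  move: (e0); rewrite ltcE /= => /andP[/eqP ie re].
  exists (complex.Re e) => // y xy; apply: xA; rewrite -ball_normE /= rnormE.
  by rewrite ltcE /= ie eqxx rdistC.
apply/nbhs_ballP; exists (e%:C) => /=; first by rewrite ltcR.
by move=> y; rewrite -ball_normE /= rnormE ltcR rdistC => /xA.
Qed.

Lemma open_rnormP V (A : set V) :
  open A <-> forall x, A x -> exists2 e, 0 < e & forall y, rnorm (y - x) < e -> A y.
Proof.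
rewrite openE; split=> [oA x /oA /nbhs_rnormP //|oA x /oA ?].
exact/nbhs_rnormP.
Qed.

Lemma bounded_set_rnorm V (A : set V) :
  bounded_set A -> exists2 M, 0 < M & forall x, A x -> rnorm x <= M.
Proof.
case=> M [Mr AM]; have [m Mm] := complex_realP _ Mr.
exists (`|m| + 1); first by rewrite ltr_wpDl.
move=> x Ax; have := AM ((`|m| + 1)%:C) _ x Ax; rewrite /= rnormE lecR; apply.
by rewrite Mm ltcR (le_lt_trans (ler_norm m)) // ltrDl.
Qed.

Lemma differentiable_rnorm V W (f : V -> W) (z : V) : differentiable f z ->
  forall e, 0 < e -> exists2 r, 0 < r & forall h, rnorm h < r ->
  rnorm (f (z + h) - f z - 'd f z h) <= e * rnorm h.
Proof.
move=> /diff_locallyP[_ /eqaddoP df] e e0.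
have := df (e%:C); rewrite ltcR => /(_ e0) /nbhs_rnormP[d d0 H].
exists d => // h hd; have := H h; rewrite subr0 => /(_ hd).
rewrite -[`|_|]/`|f (h + z) - (f z + 'd f z h)|.
by rewrite !rnormE -rmorphM /= lecR opprD addrA [h + z]addrC.
Qed.

(** [differentiable] includes continuity of the differential, which the expansion alone does not
    give for an abstract [L]; the bound [C] supplies it. *)
Lemma rnorm_differentiable V W (f : V -> W) (z : V) (L : {linear V -> W}) C :
  (forall h, rnorm (L h) <= C * rnorm h) ->
  (forall e, 0 < e -> exists2 r, 0 < r & forall h, rnorm h < r ->
    rnorm (f (z + h) - f z - L h) <= e * rnorm h) ->
  differentiable f z.
Proof.
move=> LC H.
have Lc : continuous L.
  apply/linear_bounded_continuous; exists (`|C|%:C); split.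
    by rewrite complex_real.
  move=> y; rewrite ltcE /= => /andP[/eqP iy ry].
  apply/nbhs_rnormP; exists 1 => // h; rewrite subr0 => h1 /=.
  rewrite rnormE lecE /= iy eqxx (le_trans (LC h)) // (le_trans _ (ltW ry)) //.
  rewrite -[leRHS]mulr1 (le_trans (ler_wpM2r (rnorm_ge0 _) (ler_norm C))) //.
  by rewrite ler_wpM2l // ltW.
have E : f \o shift z = cst (f z) + L +o_ 0 id.
  apply/eqaddoP => e e0.
  move: (e0); rewrite ltcE /= => /andP[/eqP ie re].
  have [r r0 Hr] := H _ re.
  apply/nbhs_rnormP; exists r => // h; rewrite subr0 => /Hr.
  rewrite -[`|_|]/`|f (h + z) - (f z + L h)|.
  have -> : e = (complex.Re e)%:C by rewrite {1}(complexE e) ie mulr0 addr0.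
  by rewrite !rnormE -rmorphM /= lecR opprD addrA [in z + h]addrC.
have dE := diff_unique Lc E.
by apply/diff_locallyP; rewrite dE.
Qed.

Lemma continuous_rnorm V W (f : V -> W) (z : V) : {for z, continuous f} ->
  forall e, 0 < e -> exists2 r, 0 < r & forall y, rnorm (y - z) < r ->
  rnorm (f y - f z) < e.
Proof.
move=> fc e e0.
have /fc /nbhs_rnormP[r r0 rP] : nbhs (f z) [set y | rnorm (y - f z) < e].
  by apply/nbhs_rnormP; exists e.
by exists r.
Qed.

Lemma differentiable_cmod (g : R[i] -> R[i]) z : differentiable g z ->
  exists l, forall e, 0 < e -> exists2 r, 0 < r & forall w, cmod (w - z) < r ->
  cmod (g w - g z - l * (w - z)) <= e * cmod (w - z).
Proof.
move=> dg; exists ('d g z 1) => e e0.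
have [r r0 rP] := differentiable_rnorm dg e0; exists r => // w wz.
have := rP (w - z) wz; rewrite [z + _]addrC subrK.
have -> : 'd g z (w - z) = 'd g z 1 * (w - z); last exact.
by rewrite -[w - z in LHS]mulr1 -[_ * 1]/(_ *: 1) linearZ /= mulrC.
Qed.

Lemma cmod_differentiable (g : R[i] -> R[i]) z l :
  (forall e, 0 < e -> exists2 r, 0 < r & forall w, cmod (w - z) < r ->
  cmod (g w - g z - l * (w - z)) <= e * cmod (w - z)) -> differentiable g z.
Proof.
move=> H.
pose L : {linear R[i] -> R[i]} := *:%R l.
apply: (@rnorm_differentiable _ _ _ _ L (cmod l)).
  by move=> h; rewrite rnormZ.
move=> e /H[r r0 rP]; exists r => // h hr.
by have := rP (z + h); rewrite [z + h - z]addrC addKr => /(_ hr).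
Qed.

End RealNorm.

(** * Goursat's theorem for Riemann sums over squares *)

Section Goursat.
Context (R : realType).
Implicit Types (g : R[i] -> R[i]) (p v s w : R[i]) (N : nat).

(** Left Riemann sum with [N] equal steps for the integral of [g] along the segment from [p] to
    [p + v]. *)
Definition edge_sum g p v N : R[i] :=
  \sum_(k < N) (v / N%:R) * g (p + k%:R * (v / N%:R)).

(** Discrete contour integral around the square with corner [p] and sides [s], ['i * s],
    counterclockwise. Opposite edges are run in the same direction and subtracted, so that a common
    edge of two squares gives literally the same term. *)
Definition square_sum g p s N : R[i] :=
  edge_sum g p s N + edge_sum g (p + s) ('i * s) N
  - edge_sum g (p + 'i * s) s N - edge_sum g p ('i * s) N.

Definition closed_square p s : set R[i] :=
  [set z | exists a b : R, [/\ 0 <= a <= 1, 0 <= b <= 1 &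
                               z = p + a%:C * s + b%:C * ('i * s)]].

Lemma edge_sum_double g p v N : (0 < N)%N ->
  edge_sum g p v (N + N) =
  edge_sum g p (v / 2) N + edge_sum g (p + v / 2) (v / 2) N.
Proof.
move=> N0; have Nn : N%:R != 0 :> R[i] by rewrite pnatr_eq0 -lt0n.
have e : v / (N + N)%:R = v / 2 / N%:R.
  by rewrite -mulrA -invfM -natrM mul2n addnn.
rewrite /edge_sum big_split_ord /= e; congr (_ + _).
apply: eq_bigr => k _; congr (_ * g _).
by rewrite natrD mulrDl -addrA; congr (_ + (_ + _)); field.
Qed.

(** The inner edges cancel exactly at finite [N], with no limit involved. *)
Lemma square_sum_double g p s N : (0 < N)%N ->
  square_sum g p s (N + N) =
  square_sum g p (s / 2) N + square_sum g (p + s / 2) (s / 2) N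
  + square_sum g (p + 'i * (s / 2)) (s / 2) N
  + square_sum g (p + s / 2 + 'i * (s / 2)) (s / 2) N.
Proof.
move=> N0; rewrite /square_sum !edge_sum_double //.
have -> : p + 'i * s + s / 2 = p + s / 2 + 'i * (s / 2) + 'i * (s / 2) by field.
have -> : p + 'i * s = p + 'i * (s / 2) + 'i * (s / 2) by field.
have -> : p + s = p + s / 2 + s / 2 by field.
have -> : p + s / 2 + s / 2 + 'i * s / 2 = p + s / 2 + 'i * (s / 2) + s / 2.
  by field.
have -> : p + 'i * (s / 2) + s / 2 = p + s / 2 + 'i * (s / 2) by field.
by rewrite -!mulrA; ring.
Qed.

Lemma edge_sumB g h p v N :
  edge_sum (fun w => g w - h w) p v N = edge_sum g p v N - edge_sum h p v N.
Proof. by rewrite /edge_sum -sumrB; apply: eq_bigr => k _; rewrite mulrBr. Qed.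

Lemma square_sumB g h p s N :
  square_sum (fun w => g w - h w) p s N =
  square_sum g p s N - square_sum h p s N.
Proof. by rewrite /square_sum !edge_sumB; ring. Qed.

(** Left Riemann sums are not exact on affine functions, but the errors on parallel edges agree;
    hence the sum around a square vanishes for every [N]. *)
Lemma edge_sum_affine (A B : R[i]) p q v N : (0 < N)%N ->
  edge_sum (fun w => A + B * w) (p + q) v N =
  edge_sum (fun w => A + B * w) p v N + v * (B * q).
Proof.
move=> N0; have Nn : N%:R != 0 :> R[i] by rewrite pnatr_eq0 -lt0n.
have -> : v * (B * q) = \sum_(k < N) (v / N%:R) * (B * q).
  by rewrite sumr_const card_ord -mulr_natr; field.
by rewrite /edge_sum -big_split; apply: eq_bigr => k _ /=; ring.
Qed.

Lemma square_sum_affine (A B : R[i]) p s N : (0 < N)%N ->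
  square_sum (fun w => A + B * w) p s N = 0.
Proof. by move=> N0; rewrite /square_sum !edge_sum_affine //; ring. Qed.

Lemma edge_sum_le g p v N M : (0 < N)%N ->
  (forall a : R, 0 <= a <= 1 -> cmod (g (p + a%:C * v)) <= M) ->
  cmod (edge_sum g p v N) <= cmod v * M.
Proof.
move=> N0 H; apply: le_trans (ler_cmod_sum _ _ _) _.
have Nn : N%:R != 0 :> R by rewrite pnatr_eq0 -lt0n.
have -> : cmod v * M = \sum_(k < N) (cmod v / N%:R) * M.
  by rewrite sumr_const card_ord -mulr_natr; field.
apply: ler_sum => k _; rewrite cmodM.
have -> : cmod (v / N%:R) = cmod v / N%:R.
  by rewrite cmodM cmodV cmod_nat.
apply: ler_wpM2l; first by rewrite divr_ge0 ?cmod_ge0.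
have -> : k%:R * (v / N%:R) = (k%:R / N%:R : R)%:C * v.
  by rewrite rmorphM fmorphV /= !rmorph_nat; ring.
apply: H; rewrite divr_ge0 //= ler_pdivrMr ?ltr0n // mul1r ler_nat.
exact/ltnW.
Qed.

Lemma square_sum_le g p s N M : (0 < N)%N ->
  (forall w, closed_square p s w -> cmod (g w) <= M) ->
  cmod (square_sum g p s N) <= 4 * cmod s * M.
Proof.
move=> N0 H.
have is_ : cmod ('i * s) = cmod s by rewrite cmodM cmodi mul1r.
have c0 : 0 <= (0 : R) <= 1 by rewrite lexx ler01.
have c1 : 0 <= (1 : R) <= 1 by rewrite lexx ler01.
have h1 : cmod (edge_sum g p s N) <= cmod s * M.
  by apply: edge_sum_le => // a a01; apply: H; exists a, 0; split=> //; ring.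
have h2 : cmod (edge_sum g (p + s) ('i * s) N) <= cmod s * M.
  rewrite -[in leRHS]is_; apply: edge_sum_le => // a a01.
  by apply: H; exists 1, a; split=> //; ring.
have h3 : cmod (edge_sum g (p + 'i * s) s N) <= cmod s * M.
  by apply: edge_sum_le => // a a01; apply: H; exists a, 1; split=> //; ring.
have h4 : cmod (edge_sum g p ('i * s) N) <= cmod s * M.
  rewrite -[in leRHS]is_; apply: edge_sum_le => // a a01.
  by apply: H; exists 0, a; split=> //; ring.
rewrite /square_sum.
have := ler_cmodB (edge_sum g p s N + edge_sum g (p + s) ('i * s) N
  - edge_sum g (p + 'i * s) s N) (edge_sum g p ('i * s) N).
have := ler_cmodB (edge_sum g p s N + edge_sum g (p + s) ('i * s) N)
  (edge_sum g (p + 'i * s) s N).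
have := ler_cmodD (edge_sum g p s N) (edge_sum g (p + s) ('i * s) N).
lra.
Qed.

End Goursat.

Section GoursatTheorem.
Context (R : realType).
Implicit Types (g : R[i] -> R[i]) (p v s w : R[i]) (c : R).

(** Stands for a contour integral of modulus at least [c]: since convergence of the sums is not
    established, only infinitely many dyadic ones are required to be large. *)
Definition square_sum_large g p s c :=
  forall J, exists2 j, (J <= j)%N & c <= cmod (square_sum g p s (2 ^ j)).

Lemma square_sum_largeN g p s c : ~ square_sum_large g p s c ->
  exists J, forall j, (J <= j)%N -> cmod (square_sum g p s (2 ^ j)) < c.
Proof.
move=> /existsNP[J H]; exists J => j Jj; rewrite ltNge; apply/negP => cj.
by apply: H; exists j.
Qed.

Lemma square_sum_large_child g p s c : square_sum_large g p s c ->
  exists ab : bool * bool, square_sum_large g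
    (p + ab.1%:R * (s / 2) + ab.2%:R * ('i * (s / 2))) (s / 2) (c / 4).
Proof.
move=> H; apply: contrapT => /forallNP nH.
have /choice[J HJ] := fun ab => square_sum_largeN (nH ab).
pose K := (J (false, false) + J (true, false) + J (false, true)
           + J (true, true))%N.
(* The exponent must be positive: one factor 2 of the number of steps is spent on the
   subdivision. *)
have [[|j] Kj] := H K.+1; first by move: Kj; rewrite ltn0.
rewrite expnS mul2n -addnn square_sum_double ?expn_gt0 //.
have KJ ab : (J ab <= j)%N by case: ab => [] [] []; rewrite /K in Kj; lia.
have := HJ (false, false) _ (KJ _).
have := HJ (true, false) _ (KJ _).
have := HJ (false, true) _ (KJ _).
have := HJ (true, true) _ (KJ _).
rewrite /= !mul1r !mul0r !addr0.
set a := square_sum g p _ _; set b := square_sum g (p + s / 2) _ _.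
set d := square_sum g (p + _ * _) _ _; set e := square_sum g (_ + _ + _) _ _.
have := ler_cmodD (a + b + d) e; have := ler_cmodD (a + b) d.
have := ler_cmodD a b; lra.
Qed.

Lemma exprn_half_lt (e : R) : 0 < e -> exists m, 2^-1 ^+ m < e :> R.
Proof.
move=> e0; exists (Num.bound e^-1).
rewrite exprVn -[ltRHS]invrK ltf_pV2 ?posrE ?invr_gt0 ?exprn_gt0 //.
apply: lt_trans (archi_boundP _) _; first by rewrite invr_ge0 ltW.
by rewrite -natrX ltr_nat ltn_expl.
Qed.

(** Classical bisection: largeness descends, with a factor 1/4, along nested squares shrinking to a
    point [z]. There the affine approximation of [g] has sum 0 and the remainder is too small. *)
Lemma goursat g p s : (forall z, closed_square p s z -> differentiable g z) ->
  forall c, 0 < c ->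
  exists J, forall j, (J <= j)%N -> cmod (square_sum g p s (2 ^ j)) < c.
Proof.
move=> dg c c0; apply: square_sum_largeN => big.
pose sq (x : R * R) := p + x.1%:C * s + x.2%:C * ('i * s).
pose side (m : nat) := (2^-1 ^+ m : R)%:C * s.
have side2 m : side m / 2 = side m.+1.
  by rewrite /side exprS rmorphM /= fmorphV /= rmorph_nat mulrC mulrA.
pose P (mx : nat * (R * R)) :=
  square_sum_large g (sq mx.2) (side mx.1) (c / 4 ^+ mx.1).
pose next (mx : nat * (R * R)) (ab : bool * bool) : R * R :=
  (mx.2.1 + ab.1%:R * 2^-1 ^+ mx.1.+1, mx.2.2 + ab.2%:R * 2^-1 ^+ mx.1.+1).
(* Putting [P mx] inside the existential makes the choice of a child total; the pair [(true, true)]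
   is a default. *)
have step mx : exists ab, P mx -> P (mx.1.+1, next mx ab).
  have [Pmx|nP] := pselect (P mx); last by exists (true, true).
  have [ab H] := square_sum_large_child Pmx; exists ab => _.
  have -> : P (mx.1.+1, next mx ab) = square_sum_large g
    (sq mx.2 + ab.1%:R * (side mx.1 / 2) + ab.2%:R * ('i * (side mx.1 / 2)))
    (side mx.1 / 2) (c / 4 ^+ mx.1 / 4); last exact: H.
  rewrite /P /= side2; congr (square_sum_large _ _ _ _).
    by rewrite /sq /next /= /side !rmorphD !rmorphM /= !rmorph_nat; ring.
  by rewrite exprSr invfM mulrA.
have [F FP] := choice step.
pose x := fix x m : R * R :=
  if m is k.+1 then next (k, x k) (F (k, x k)) else (0, 0).
have Px m : P (m, x m).
  elim: m => [|m IH]; last exact: FP IH.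
  rewrite /P /= /sq /side /= !mul0r !addr0 mul1r expr0 divr1; exact: big.
have P0 m : 0 < 2^-1 ^+ m :> R by rewrite exprn_gt0.
have nextE (ab : bool) m (y : R) : y <= y + ab%:R * 2^-1 ^+ m.+1 /\
    y + ab%:R * 2^-1 ^+ m.+1 + 2^-1 ^+ m.+1 <= y + 2^-1 ^+ m.
  have := P0 m; rewrite exprS; case: ab; rewrite ?mul1r ?mul0r => ?; split; lra.
have nested (X : nat -> R) (ab : nat -> bool) :
    (forall m, X m.+1 = X m + (ab m)%:R * 2^-1 ^+ m.+1) ->
    exists y, forall m, X m <= y <= X m + 2^-1 ^+ m.
  move=> XS.
  have up m k : (m <= k)%N -> X m <= X k /\ X k + 2^-1 ^+ k <= X m + 2^-1 ^+ m.
    elim: k => [|k IH]; first by rewrite leqn0 => /eqP ->.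
    rewrite leq_eqVlt => /orP[/eqP <- //|/IH[h1 h2]].
    have [] := nextE (ab k) k (X k); rewrite -XS => ? ?; split; lra.
  have ub m : ubound (range X) (X m + 2^-1 ^+ m).
    move=> _ [k _ <-]; have [/up[]|/ltnW/up[]] := leqP m k.
      by have := P0 k; lra.
    by have := P0 m; lra.
  exists (sup (range X)) => m; apply/andP; split.
    by apply: ub_le_sup; [exists (X 0%N + 2^-1 ^+ 0); exact: ub | exists m].
  by apply: ge_sup; [exists (X 0%N); exists 0%N | exact: ub].
have [y1 y1P] := nested (fun m => (x m).1) (fun k => (F (k, x k)).1)
  (fun m => erefl).
have [y2 y2P] := nested (fun m => (x m).2) (fun k => (F (k, x k)).2)
  (fun m => erefl).
pose z := sq (y1, y2).
have Qz : closed_square p s z.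
  exists y1, y2; have := y1P 0%N; have := y2P 0%N.
  by rewrite /= expr0 add0r => ? ?; split.
have [s0|s0] := eqVneq (cmod s) 0.
  have [j _] := big 0%N; apply/negP; rewrite -ltNge.
  have Q1 w : closed_square p s w -> cmod (g w - 0) <= cmod (g p).
    move: s0 => /cmod_eq0 ->.
    by case=> a [b [_ _ ->]]; rewrite !mulr0 !addr0 subr0.
  apply: le_lt_trans (square_sum_le (M := cmod (g p)) _ _) _.
  - by rewrite expn_gt0.
  - by move=> w /Q1; rewrite subr0.
  - by rewrite s0 mulr0 mul0r.
have sp : 0 < cmod s by rewrite lt_neqAle eq_sym s0 cmod_ge0.
(* At level [m], with [q = 2^-m], the edges have total length [4 q |s|] and the remainder is at most
   [e * 2 q |s|]; the product is [c q^2 / 2], below the required [c / 4^m = c q^2]. *)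
pose e := c / (16 * cmod s ^+ 2).
have e0 : 0 < e by rewrite divr_gt0 // mulr_gt0 // exprn_gt0.
have [B /(_ e e0)[r r0 rP]] := differentiable_cmod (dg z Qz).
have r2 : 0 < r / (3 * cmod s) by rewrite divr_gt0 // mulr_gt0.
have [m mr] := exprn_half_lt r2.
set q := 2^-1 ^+ m in mr; have q0 : 0 < q := P0 m.
have qr : 2 * q * cmod s < r.
  by move: mr; rewrite ltr_pdivlMr ?mulr_gt0 // mulrA; nra.
pose A := g z - B * z.
have close w : closed_square (sq (x m)) (side m) w ->
    cmod (g w - (A + B * w)) <= e * (2 * q * cmod s).
  move=> [a [b [/andP[a0 a1] /andP[b0 b1] wE]]].
  have wz : cmod (w - z) <= 2 * q * cmod s.
    have -> : w - z = ((x m).1 + a * q - y1)%:C * s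
                      + ((x m).2 + b * q - y2)%:C * ('i * s).
      by rewrite wE /z /sq /side -/q !rmorphB !rmorphD !rmorphM /=; ring.
    apply: le_trans (ler_cmodD _ _) _; rewrite !cmodM !cmod_real cmodi mul1r.
    rewrite -mulrDl ler_wpM2r ?cmod_ge0 //.
    have /andP[h1 h2] := y1P m; have /andP[h3 h4] := y2P m.
    have : `|(x m).1 + a * q - y1| <= q.
      by rewrite ler_norml; apply/andP; split; move: h1 h2; rewrite -/q; nra.
    have : `|(x m).2 + b * q - y2| <= q.
      by rewrite ler_norml; apply/andP; split; move: h3 h4; rewrite -/q; nra.
    lra.
  have h := rP _ (le_lt_trans wz qr).
  have -> : g w - (A + B * w) = g w - g z - B * (w - z) by rewrite /A; ring.
  by apply: le_trans h _; rewrite ler_wpM2l // ltW.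
have [j _] := Px m 0%N; apply/negP; rewrite -ltNge.
have j0 : (0 < 2 ^ j)%N by rewrite expn_gt0.
have := square_sum_le j0 close.
rewrite square_sumB square_sum_affine // subr0 => h; apply: le_lt_trans h _.
rewrite /side cmodM cmod_real gtr0_norm // -/q /e.
have -> : 4 ^+ m = q^-1 ^+ 2.
  have -> : 4 = 2 ^+ 2 :> R by ring.
  by rewrite /q [2^-1 ^+ m]exprVn invrK -!exprM mulnC.
have -> : 4 * (q * cmod s) * (c / (16 * cmod s ^+ 2) * (2 * q * cmod s)) =
  c * q ^+ 2 / 2 by field; rewrite gt_eqF.
rewrite exprVn invrK; have : 0 < c * q ^+ 2 by rewrite mulr_gt0 // exprn_gt0.
lra.
Qed.

End GoursatTheorem.

(** * Cauchy's inequality at the centre of a square *)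

Section CauchyCenter.
Context (R : realType).
Implicit Types (g F : R[i] -> R[i]) (p v s w : R[i]) (N : nat).

Lemma cmod_addi_ge1 (a : R) : 1 <= cmod (1 + a%:C * 'i).
Proof.
have := ler_Re_cmod (1 + a%:C * 'i); apply: le_trans.
by rewrite /= !mulr0 mul0r subr0 addr0 normr1.
Qed.

Definition locally_bounded_at g p :=
  exists r K, 0 < r /\ forall z, cmod (z - p) < r -> cmod (g z) <= K.

Lemma differentiable_id_sub p w : differentiable (fun z => z - p) w.
Proof. exact: differentiableB. Qed.

(** At [z = p] the value is [0 / 0 = 0], not the derivative; near [p] only boundedness is used. *)
Definition dquot F p z := (F z - F p) / (z - p).

Lemma differentiable_dquot F p w : differentiable F w -> w != p ->
  differentiable (dquot F p) w.
Proof.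
move=> dF wa; apply: differentiableM; first exact: differentiableB.
by apply: differentiableV; [exact: differentiable_id_sub | rewrite subr_eq0].
Qed.

Lemma dquot_locally_bounded F p : differentiable F p ->
  locally_bounded_at (dquot F p) p.
Proof.
move=> /differentiable_cmod[l /(_ 1 ltr01)[r r0 rP]].
exists r, (1 + cmod l); split=> // z zr; rewrite /dquot.
have [->|za] := eqVneq z p.
  by rewrite !subrr mul0r cmod0 addr_ge0 ?cmod_ge0.
have zp : 0 < cmod (z - p) by rewrite cmod_gt0 subr_eq0.
rewrite cmodM cmodV ler_pdivrMr //; have h := rP z zr.
by apply: le_trans (ler_cmod_sub _ (l * (z - p))) _; rewrite cmodM; lra.
Qed.

(** Three of the four half-size squares avoid 0, so Goursat's theorem applies to each of them with
    [e / 3]. *)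
Lemma goursat_corner_half g s : s != 0 ->
  (forall z, closed_square 0 s z -> z != 0 -> differentiable g z) ->
  forall e, 0 < e -> exists J, forall j, (J <= j)%N ->
  cmod (square_sum g 0 s (2 ^ j.+1)) < e + cmod (square_sum g 0 (s / 2) (2 ^ j)).
Proof.
move=> s0 dg e e0; have e3 : 0 < e / 3 by rewrite divr_gt0.
(* In the squares away from the corner some coordinate is at least 1/2, which keeps their points off
   0. *)
have sub (x y a b : R) z : 0 <= x <= 2^-1 -> 0 <= y <= 2^-1 ->
    0 <= a <= 1 -> 0 <= b <= 1 -> x = 2^-1 \/ y = 2^-1 ->
    z = (x + a / 2)%:C * s + (y + b / 2)%:C * ('i * s) -> differentiable g z.
  move=> x01 y01 a01 b01 xyh ->; apply: dg.
    exists (x + a / 2), (y + b / 2); split; rewrite ?add0r //; lra.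
  rewrite mulrA -mulrDl mulf_neq0 //; apply/negP => /eqP.
  move=> /(congr1 (fun z : R[i] => (complex.Re z, complex.Im z))).
  rewrite /= => -[]; case: xyh => ->; lra.
have hI : 0 <= (2^-1 : R) <= 2^-1 by lra.
have h0 : 0 <= (0 : R) <= 2^-1 by lra.
have half (a : R) : (a / 2)%:C = a%:C / 2 :> R[i].
  by rewrite rmorphM fmorphV /= rmorph_nat.
have half1 : (2^-1)%:C = 2^-1 :> R[i] by rewrite fmorphV /= rmorph_nat.
have [J1 H1] : exists J, forall j, (J <= j)%N ->
    cmod (square_sum g (0 + s / 2) (s / 2) (2 ^ j)) < e / 3.
  apply: goursat => // z [a [b [a01 b01 ->]]].
  apply: (sub _ _ _ _ _ hI h0 a01 b01); first by left.
  by rewrite !rmorphD /= !half half1 ?rmorph0; ring.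
have [J2 H2] : exists J, forall j, (J <= j)%N ->
    cmod (square_sum g (0 + 'i * (s / 2)) (s / 2) (2 ^ j)) < e / 3.
  apply: goursat => // z [a [b [a01 b01 ->]]].
  apply: (sub _ _ _ _ _ h0 hI a01 b01); first by right.
  by rewrite !rmorphD /= !half half1 ?rmorph0; ring.
have [J3 H3] : exists J, forall j, (J <= j)%N ->
    cmod (square_sum g (0 + s / 2 + 'i * (s / 2)) (s / 2) (2 ^ j)) < e / 3.
  apply: goursat => // z [a [b [a01 b01 ->]]].
  apply: (sub _ _ _ _ _ hI hI a01 b01); first by left.
  by rewrite !rmorphD /= !half half1 ?rmorph0; ring.
exists (J1 + J2 + J3)%N => j Jj.
have {}H1 : _ < _ := H1 j ltac:(clear -Jj; lia).
have {}H2 : _ < _ := H2 j ltac:(clear -Jj; lia).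
have {}H3 : _ < _ := H3 j ltac:(clear -Jj; lia).
rewrite expnS mul2n -addnn square_sum_double ?expn_gt0 //.
move: H1 H2 H3.
set a := square_sum g 0 _ _; set b := square_sum g (0 + s / 2) _ _.
set d := square_sum g (0 + _ * _) _ _; set f := square_sum g (_ + _ + _) _ _.
have := ler_cmodD (a + b + d) f; have := ler_cmodD (a + b) d.
have := ler_cmodD a b; lra.
Qed.

(* A singularity at a corner does not matter as long as g stays bounded: the
   squares of the dyadic subdivision meeting it are negligible. *)
Lemma goursat_corner g s : s != 0 ->
  (forall z, closed_square 0 s z -> z != 0 -> differentiable g z) ->
  locally_bounded_at g 0 ->
  forall e, 0 < e -> exists J, forall j, (J <= j)%N ->
  cmod (square_sum g 0 s (2 ^ j)) < e.
Proof.
move=> s0 dg [r [M [r0 gM]]] e e0.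
have half2 m t : t / 2 ^+ m.+1 = t / 2 / 2 ^+ m :> R[i].
  by rewrite exprS invfM mulrA.
have iterh m : forall t, t != 0 ->
    (forall z, closed_square 0 t z -> z != 0 -> differentiable g z) ->
    forall d, 0 < d -> exists J, forall j, (J <= j)%N ->
    cmod (square_sum g 0 t (2 ^ (j + m))) <
    d + cmod (square_sum g 0 (t / 2 ^+ m) (2 ^ j)).
  elim: m => [|m IH] t t0 dt d d0.
    by exists 0%N => j _; rewrite addn0 expr0 divr1; lra.
  have d2 : 0 < d / 2 by rewrite divr_gt0.
  have [J1 H1] := goursat_corner_half t0 dt d2.
  have t20 : t / 2 != 0 by rewrite mulf_neq0 // invr_eq0 pnatr_eq0.
  have [|J2 H2] := IH (t / 2) t20 _ _ d2.
    move=> z [a [b [a01 b01 ->]]] z0; apply: dt => //.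
    exists (a / 2), (b / 2); split; [lra|lra|].
    by rewrite !rmorphM !fmorphV /= !rmorph_nat; ring.
  exists (J1 + J2)%N => j Jj.
  have := H1 (j + m)%N ltac:(clear -Jj; lia); have := H2 j ltac:(clear -Jj; lia).
  rewrite half2 addnS; lra.
pose K := r + 4 * `|M| + 1.
have K0 : 0 < K by rewrite /K; have := normr_ge0 M; lra.
have sp : 0 < cmod s by rewrite cmod_gt0.
(* Chosen so that the corner square of side [2^-m |s|] lies in the ball where [g] is bounded and its
   sum, at most [4 * 2^-m |s| M], stays below [e / 2]. *)
pose d := Num.min r (e / 2 / (4 * `|M| + 1)) / (2 * cmod s).
have M0 : 0 < 4 * `|M| + 1 by have := normr_ge0 M; lra.
have d0 : 0 < d.
  by rewrite divr_gt0 ?mulr_gt0 // lt_min r0 !divr_gt0.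
have [m] := exprn_half_lt d0; rewrite ltr_pdivlMr ?mulr_gt0 // lt_min.
set q := 2^-1 ^+ m => /andP[mr me].
have q0 : 0 < q by rewrite exprn_gt0.
have sq : cmod (s / 2 ^+ m) = q * cmod s.
  by rewrite mulrC cmodM cmodV cmodX cmod_nat /q exprVn.
have [J HJ] := iterh m s s0 dg (e / 2) ltac:(by rewrite divr_gt0).
exists (J + m)%N => j Jj.
have mj : (m <= j)%N by clear -Jj; lia.
have := HJ (j - m)%N ltac:(clear -Jj; lia); rewrite subnK //.
have : cmod (square_sum g 0 (s / 2 ^+ m) (2 ^ (j - m))) <=
    4 * cmod (s / 2 ^+ m) * M.
  apply: square_sum_le; first by rewrite expn_gt0.
  move=> w [a [b [/andP[a0 a1] /andP[b0 b1] ->]]]; apply: gM; rewrite subr0 add0r.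
  apply: le_lt_trans (ler_cmodD _ _) _.
  rewrite [cmod (a%:C * _)]cmodM [cmod (b%:C * _)]cmodM [cmod ('i * _)]cmodM.
  rewrite !cmod_real cmodi sq !ger0_norm // mul1r.
  apply: le_lt_trans mr; have : 0 <= q * cmod s by rewrite mulr_ge0 // ltW.
  nra.
rewrite sq; move: me; rewrite ltr_pdivlMr //.
have : M <= `|M| by exact: ler_norm.
have : 0 < q * cmod s by rewrite mulr_gt0.
nra.
Qed.

(** The part of [square_sum g 0 s] coming from the two edges that do not contain 0. *)
Definition corner_sum g s N : R[i] :=
  edge_sum g s ('i * s) N - edge_sum g ('i * s) s N.

Lemma mul_i_i (s : R[i]) : 'i * ('i * s) = - s.
Proof. by rewrite mulrA -expr2 sqr_i mulN1r. Qed.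

(** The rotations by ['i] of a square with corner 0 tile a square centred at 0: the edges issuing
    from 0 cancel and the outer boundary remains. *)
Lemma square_sum_corners g s N :
  square_sum g 0 s N + square_sum g 0 ('i * s) N + square_sum g 0 (- s) N
  + square_sum g 0 ('i * - s) N =
  corner_sum g s N + corner_sum g ('i * s) N + corner_sum g (- s) N
  + corner_sum g ('i * - s) N.
Proof. by rewrite /square_sum /corner_sum !add0r !mul_i_i opprK; ring. Qed.

(** The form [dw / w] is invariant under [w -> c w], and so are its Riemann sums; the four rotated
    corners therefore contribute equally. *)
Lemma edge_sumV_rot c p v N : c != 0 ->
  edge_sum (@GRing.inv _) (c * p) (c * v) N = edge_sum (@GRing.inv _) p v N.
Proof.
move=> c0; apply: eq_bigr => k _.
have -> : c * p + k%:R * (c * v / N%:R) = c * (p + k%:R * (v / N%:R)) by ring.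
set q := (p + _); rewrite invfM.
transitivity ((c / c) * (v / N%:R / q)); first by ring.
by rewrite divff // mul1r.
Qed.

Lemma corner_sumV s N : s != 0 ->
  corner_sum (@GRing.inv _) s N = corner_sum (@GRing.inv _) 1 N.
Proof.
move=> s0; rewrite /corner_sum mulr1 -{1 4}[s]mulr1 [_ * 1 in X in X - _]mulr1.
rewrite -(edge_sumV_rot 1 'i N s0) -(edge_sumV_rot 'i 1 N s0) mulr1.
by rewrite [s * 'i]mulrC.
Qed.

Lemma corner_sumV1 N : (0 < N)%N -> 1 <= cmod (corner_sum (@GRing.inv R[i]) 1 N).
Proof.
move=> N0; have Nn : N%:R != 0 :> R by rewrite pnatr_eq0 -lt0n.
pose t (k : 'I_N) : R := k%:R / N%:R.
have -> : corner_sum (@GRing.inv _) 1 N =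
    'i * (\sum_(k < N) N%:R^-1 * (2 / (1 + t k ^+ 2)))%:C.
  rewrite /corner_sum /edge_sum -sumrB rmorph_sum mulr_sumr /=.
  apply: eq_bigr => k _; rewrite !mulr1 !mul1r.
  have -> : k%:R * N%:R^-1 = (t k)%:C :> R[i].
    by rewrite rmorphM fmorphV /= !rmorph_nat.
  have -> : k%:R * ('i / N%:R) = (t k)%:C * 'i.
    by rewrite rmorphM fmorphV /= !rmorph_nat; ring.
  move: (t k) => {t} t.
  rewrite !rmorphM !fmorphV !rmorphD !rmorphXn /= !rmorph_nat rmorph1.
  have i2 : 'i * 'i = -1 :> R[i] by rewrite -expr2 sqr_i.
  have c0 : 1 + t%:C ^+ 2 != 0 :> R[i].
    rewrite -[1](rmorph1 (real_complex R)) -rmorphXn -rmorphD /=.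
    by rewrite fmorph_eq0 gt_eqF // ltr_wpDr ?sqr_ge0.
  set u := t%:C in c0 *; set c := (1 + u ^+ 2)^-1.
  have cE : c * (1 + u ^+ 2) = 1 by rewrite mulVf.
  have -> : (1 + u * 'i)^-1 = (1 - u * 'i) * c.
    by apply: mulr1_eq; rewrite -[RHS]cE; ring: i2.
  have -> : ('i + u)^-1 = - ('i * (1 + u * 'i) * c).
    by apply: mulr1_eq; rewrite -[RHS]cE; ring: i2.
  by ring: i2.
rewrite cmodM cmodi mul1r cmod_real ger0_norm; last first.
  by apply: sumr_ge0 => k _; rewrite mulr_ge0 // divr_ge0 // addr_ge0 ?sqr_ge0.
have {1}-> : (1 : R) = \sum_(k < N) N%:R^-1 * 1.
  by rewrite sumr_const card_ord -mulr_natr; field.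
apply: ler_sum => k _; apply: ler_wpM2l; first by rewrite invr_ge0.
rewrite ler_pdivlMr ?mul1r.
  rewrite -lerBrDl; have -> : 2 - 1 = 1 :> R by ring.
  by rewrite exprn_ile1 ?divr_ge0 // ler_pdivrMr ?ltr0n // mul1r ler_nat ltnW.
by rewrite ltr_wpDr ?sqr_ge0.
Qed.

Lemma cmod_edge1 (a : R) s : cmod s <= cmod (s + a%:C * ('i * s)).
Proof.
have -> : s + a%:C * ('i * s) = (1 + a%:C * 'i) * s by ring.
by rewrite cmodM ler_peMl ?cmod_ge0 // cmod_addi_ge1.
Qed.

Lemma cmod_edge2 (a : R) s : cmod s <= cmod ('i * s + a%:C * s).
Proof.
have -> : 'i * s + a%:C * s = 'i * s + (- a)%:C * ('i * ('i * s)).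
  by rewrite mul_i_i rmorphN; ring.
by apply: le_trans (cmod_edge1 _ _); rewrite cmodM cmodi mul1r.
Qed.

Lemma cmod_edge_le (a : R) p v s : 0 <= a <= 1 -> cmod p = cmod s ->
  cmod v = cmod s -> cmod (p + a%:C * v) <= 2 * cmod s.
Proof.
move=> a01 ps vs; apply: le_trans (ler_cmodD _ _) _.
rewrite cmodM cmod_real ps vs; have := cmod_ge0 s.
by rewrite ger0_norm; [nra | lra].
Qed.

Lemma corner_sum_div_le F s N M : (0 < N)%N -> s != 0 -> 0 <= M ->
  (forall w, cmod s <= cmod w <= 2 * cmod s -> cmod (F w) <= M) ->
  cmod (corner_sum (fun w => F w / w) s N) <= 2 * M.
Proof.
move=> N0 s0 M0 FM; have sp : 0 < cmod s by rewrite cmod_gt0.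
have is_ : cmod ('i * s) = cmod s by rewrite cmodM cmodi mul1r.
have K w : cmod s <= cmod w <= 2 * cmod s -> cmod (F w / w) <= M / cmod s.
  move=> /andP[w1 w2]; rewrite cmodM cmodV ler_pM ?invr_ge0 ?cmod_ge0 //.
    by rewrite FM // w1.
  by rewrite lef_pV2 // ?posrE // (lt_le_trans sp).
apply: le_trans (ler_cmodB _ _) _.
have -> : 2 * M = cmod ('i * s) * (M / cmod s) + cmod s * (M / cmod s).
  by rewrite is_; field; rewrite gt_eqF.
apply: lerD; apply: edge_sum_le => // a a01; apply: K.
  by rewrite cmod_edge1 cmod_edge_le.
by rewrite cmod_edge2 cmod_edge_le.
Qed.

Lemma corner_sum_kernel F s N : s != 0 ->
  corner_sum (dquot F 0) s N =
  corner_sum (fun w => F w / w) s N - F 0 * corner_sum (@GRing.inv _) 1 N.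
Proof.
move=> s0; rewrite -(corner_sumV N s0) /corner_sum.
have E p v : edge_sum (dquot F 0) p v N =
    edge_sum (fun w => F w / w) p v N - F 0 * edge_sum (@GRing.inv _) p v N.
  rewrite mulr_sumr -sumrB; apply: eq_bigr => k _.
  by rewrite /dquot subr0 mulrBl mulrBr; congr (_ - _); rewrite mulrCA.
by rewrite !E mulrBr; ring.
Qed.

(* A crude Cauchy inequality; the constant is removed later by applying it to
   powers. *)
Lemma cauchy_center_crude F (L M : R) : 0 < L ->
  (forall w, cmod w <= 2 * L -> differentiable F w) ->
  (forall w, L <= cmod w <= 2 * L -> cmod (F w) <= M) ->
  cmod (F 0) <= 2 * M.
Proof.
move=> L0 dF FM; pose g := dquot F 0.
have M0 : 0 <= M.
  apply: le_trans (cmod_ge0 (F L%:C)) _; apply: FM; rewrite cmod_real gtr0_norm //.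
  by rewrite lexx; lra.
have dF0 : differentiable F 0 by apply: dF; rewrite cmod0 mulr_ge0 // ltW.
have small s : cmod s = L -> forall e, 0 < e -> exists J, forall j, (J <= j)%N ->
    cmod (square_sum g 0 s (2 ^ j)) < e.
  move=> sL; have s0 : s != 0 by rewrite -cmod_gt0 sL.
  apply: (goursat_corner s0) (dquot_locally_bounded dF0) => z Qz z0.
  apply: (differentiable_dquot _ z0); apply: dF.
  case: Qz => a [b [a01 b01 ->]].
  rewrite add0r; apply: le_trans (ler_cmodD _ _) _.
  rewrite !cmodM cmodi !cmod_real mul1r sL !ger0_norm; nra.
pose s := L%:C : R[i].
have sL : cmod s = L by rewrite cmod_real gtr0_norm.
have s1L : cmod ('i * s) = L by rewrite cmodM cmodi mul1r.
have s2L : cmod (- s) = L by rewrite cmodN.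
have s3L : cmod ('i * - s) = L by rewrite cmodM cmodi mul1r.
apply/ler_addgt0Pr => e e0.
have [J0 H0] := small _ sL e e0; have [J1 H1] := small _ s1L e e0.
have [J2 H2] := small _ s2L e e0; have [J3 H3] := small _ s3L e e0.
pose j := (J0 + J1 + J2 + J3)%N.
have [j0 j1 j2 j3] : [/\ J0 <= j, J1 <= j, J2 <= j & J3 <= j]%N.
  by rewrite /j; clear; split; lia.
have {H0}H0 := H0 j j0; have {H1}H1 := H1 j j1.
have {H2}H2 := H2 j j2; have {H3}H3 := H3 j j3.
have N0 : (0 < 2 ^ j)%N by rewrite expn_gt0.
have nz t : cmod t = L -> t != 0 by move=> tL; rewrite -cmod_gt0 tL.
have B t : cmod t = L ->
    cmod (corner_sum (fun w => F w / w) t (2 ^ j)) <= 2 * M.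
  by move=> tL; apply: corner_sum_div_le; rewrite ?nz ?tL.
(* With [k] the corner sum of [1 / w], this expresses [4 * F 0 * k] by four sums of [F w / w], each
   at most [2 * M], and four sums of [g], each below [e]; then [|k| >= 1] concludes. *)
have := square_sum_corners g s (2 ^ j).
rewrite !corner_sum_kernel ?nz //.
move: (B _ sL) (B _ s1L) (B _ s2L) (B _ s3L) H0 H1 H2 H3.
move: (square_sum g 0 s _) (square_sum g 0 ('i * s) _)
  (square_sum g 0 (- s) _) (square_sum g 0 ('i * - s) _) => a0 a1 a2 a3.
move: (corner_sum _ s _) (corner_sum _ ('i * s) _) (corner_sum _ (- s) _)
  (corner_sum _ ('i * - s) _) => b0 b1 b2 b3.
have := corner_sumV1 N0; set k := corner_sum _ 1 _ => k1.
move=> hb0 hb1 hb2 hb3 ha0 ha1 ha2 ha3 E.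
have {}E : 4 * (F 0 * k) = (b0 + b1 + b2 + b3) - (a0 + a1 + a2 + a3).
  by rewrite E; ring.
have : cmod (4 * (F 0 * k)) <= 4 * (2 * M) + 4 * e.
  rewrite E; apply: le_trans (ler_cmodB _ _) _.
  have := ler_cmodD (b0 + b1 + b2) b3; have := ler_cmodD (b0 + b1) b2.
  have := ler_cmodD b0 b1.
  have := ler_cmodD (a0 + a1 + a2) a3; have := ler_cmodD (a0 + a1) a2.
  have := ler_cmodD a0 a1; lra.
rewrite !cmodM cmod_nat => h; have := cmod_ge0 (F 0); nra.
Qed.

End CauchyCenter.

(** * Divided differences *)

Section DividedDifferences.
Context (R : realType).
Implicit Types (f g h F : R[i] -> R[i]) (a b c w z : R[i]) (r K M L : R).

Lemma locally_bounded_atM g h a : locally_bounded_at g a ->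
  locally_bounded_at h a -> locally_bounded_at (fun z => g z * h z) a.
Proof.
move=> [r [K [r0 gK]]] [r' [K' [r'0 hK']]].
exists (Num.min r r'), (K * K'); rewrite lt_min r0; split=> // z.
rewrite lt_min => /andP[/gK ? /hK' ?].
by rewrite cmodM ler_pM ?cmod_ge0.
Qed.

Lemma locally_bounded_atX g a n : locally_bounded_at g a ->
  locally_bounded_at (fun z => g z ^+ n) a.
Proof.
move=> [r [K [r0 gK]]]; exists r, (K ^+ n); split=> // z /gK ?.
by rewrite cmodX lerXn2r ?nnegrE ?(le_trans (cmod_ge0 (g z))) ?cmod_ge0.
Qed.

Lemma differentiable_locally_bounded g a : differentiable g a ->
  locally_bounded_at g a.
Proof.
move=> /differentiable_continuous gc.
have [r r0 rP] := continuous_rnorm gc ltr01.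
exists r, (1 + cmod (g a)); split=> // z /rP/ltW h.
by apply: le_trans (ler_cmod_sub _ (g a)) _; rewrite lerD2r.
Qed.

(** The product is [O(|z - a|^2)], hence has derivative 0 at [a]. *)
Lemma differentiable_sqr_mul g a : locally_bounded_at g a ->
  differentiable (fun z => g z * (z - a) ^+ 2) a.
Proof.
move=> [r [K [r0 gK]]]; apply: (@cmod_differentiable _ _ _ 0) => e e0.
have K0 : 0 <= K.
  by apply: le_trans (cmod_ge0 (g a)) (gK a _); rewrite subrr cmod0.
have d0 : 0 < Num.min r (e / (K + 1)).
  by rewrite lt_min r0 divr_gt0 // ltr_wpDl.
exists (Num.min r (e / (K + 1))) => // w.
rewrite lt_min => /andP[/gK gw]; rewrite ltr_pdivlMr ?ltr_wpDl // => we.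
rewrite subrr expr0n mulr0 subr0 mul0r subr0 cmodM cmodX expr2 mulrA.
rewrite ler_wpM2r ?cmod_ge0 //.
apply: le_trans (ler_wpM2r (cmod_ge0 _) gw) _; have := cmod_ge0 (w - a); nra.
Qed.

Lemma differentiable_expr g n w : differentiable g w ->
  differentiable (fun z => g z ^+ n) w.
Proof.
move=> dg; elim: n => [|n IH]; first exact: differentiable_cst.
have -> : (fun z => g z ^+ n.+1) = (fun z => g z * g z ^+ n).
  by apply/funext => z; rewrite exprS.
exact: differentiableM.
Qed.

(** If [m < x], the powers of [x / m] grow at least linearly by Bernoulli's inequality, whereas the
    hypothesis bounds them by [B / A]. *)
Lemma power_bound_le (x m A B : R) : 0 <= x -> 0 <= m -> 0 < A ->
  (forall n, x ^+ n.+1 * A <= B * m ^+ n.+1) -> x <= m.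
Proof.
move=> x0 m0 A0 H; rewrite leNgt; apply/negP => mx.
have xp : 0 < x by apply: le_lt_trans mx.
have [m0'|m1] := eqVneq m 0.
  have := H 0%N; rewrite m0' !expr1 mulr0; apply/negP; rewrite -ltNge.
  exact: mulr_gt0.
have mp : 0 < m by rewrite lt_neqAle eq_sym m1.
pose y := x / m - 1; have y0 : 0 < y by rewrite subr_gt0 ltr_pdivlMr ?mul1r.
have bern n : 1 + n%:R * y <= (x / m) ^+ n.
  have -> : x / m = 1 + y by rewrite /y; ring.
  elim: n => [|n IH]; first by rewrite mul0r addr0 expr0.
  rewrite exprS; apply: le_trans (ler_wpM2l _ IH); last by lra.
  have := ler0n R n; rewrite -natr1; nra.
have yA : 0 < y * A by rewrite mulr_gt0.
have Bb n : n%:R <= `|B| / (y * A).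
  rewrite ler_pdivlMr //.
  have := H n; rewrite -ler_pdivrMr ?exprn_gt0 // mulrAC -expr_div_n => h.
  have := bern n.+1; have := ler_norm B; rewrite -natr1; nra.
have := archi_boundP (divr_ge0 (normr_ge0 B) (ltW yA)).
by rewrite ltNge Bb.
Qed.

Lemma cauchy_center_crude_at F c L M : 0 < L ->
  (forall w, cmod (w - c) <= 2 * L -> differentiable F w) ->
  (forall w, L <= cmod (w - c) <= 2 * L -> cmod (F w) <= M) ->
  cmod (F c) <= 2 * M.
Proof.
move=> L0 dF FM; rewrite -[c in leLHS]add0r.
apply: (@cauchy_center_crude _ (fun w => F (w + c)) L _ L0) => w wL.
  apply: (@differentiable_comp _ _ _ _ (fun w => w + c) F).
    exact: differentiableD.
  by apply: dF; rewrite addrK.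
by apply: FM; rewrite addrK.
Qed.

(* Landau's trick: the crude Cauchy inequality for the powers of h, the factor
   killing the singularities a and b. *)
Lemma cauchy_center h a b c L M : 0 < L -> c != a -> c != b ->
  (forall w, cmod (w - c) <= 2 * L -> w != a -> w != b -> differentiable h w) ->
  locally_bounded_at h a -> locally_bounded_at h b ->
  (forall w, L <= cmod (w - c) <= 2 * L -> cmod (h w) <= M) ->
  cmod (h c) <= M.
Proof.
move=> L0 ca cb dh ha hb hM.
have M0 : 0 <= M.
  apply: le_trans (cmod_ge0 (h (L%:C + c))) (hM _ _).
  by rewrite addrK cmod_real gtr0_norm // lexx; lra.
pose P w := (w - a) ^+ 2 * (w - b) ^+ 2.
(* [D] bounds [P] on the disc, and [P c] is nonzero because [c] differs from [a] and [b]; the powers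
   then make [2 * D] and [|P c|] irrelevant. *)
pose D := (2 * L + cmod (c - a)) ^+ 2 * (2 * L + cmod (c - b)) ^+ 2.
apply: (@power_bound_le _ _ (cmod (P c)) (2 * D)) => //; first exact: cmod_ge0.
  by rewrite cmod_gt0 mulf_neq0 ?expf_neq0 // subr_eq0.
move=> n; rewrite -cmodX -cmodM -mulrA.
have db k w : differentiable (fun z => (z - k) ^+ 2 : R[i]) w.
  by apply: differentiable_expr; exact: differentiable_id_sub.
apply: (@cauchy_center_crude_at (fun w => h w ^+ n.+1 * P w) c L _ L0) => w wL.
  have [->|wa] := eqVneq w a.
    have -> : (fun w => h w ^+ n.+1 * P w) =
        (fun w => h w ^+ n.+1 * (w - b) ^+ 2 * (w - a) ^+ 2).
      by apply/funext => z; rewrite /P mulrA mulrAC.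
    apply/differentiable_sqr_mul/locally_bounded_atM.
      exact: locally_bounded_atX.
    exact/differentiable_locally_bounded.
  have [->|wb] := eqVneq w b.
    have -> : (fun w => h w ^+ n.+1 * P w) =
        (fun w => h w ^+ n.+1 * (w - a) ^+ 2 * (w - b) ^+ 2).
      by apply/funext => z; rewrite /P mulrA.
    apply/differentiable_sqr_mul/locally_bounded_atM.
      exact: locally_bounded_atX.
    exact/differentiable_locally_bounded.
  apply: differentiableM; first by apply: differentiable_expr; exact: dh.
  exact: differentiableM.
have kb k : cmod ((w - k) ^+ 2) <= (2 * L + cmod (c - k)) ^+ 2.
  rewrite cmodX lerXn2r ?nnegrE ?addr_ge0 ?cmod_ge0 ?mulr_ge0 ?(ltW L0) //.
  have -> : w - k = (w - c) + (c - k) by ring.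
  by apply: le_trans (ler_cmodD _ _) _; rewrite lerD2r; case/andP: wL.
rewrite cmodM mulrC /P cmodM /D.
apply: ler_pM; rewrite ?mulr_ge0 ?cmod_ge0 //.
  by apply: ler_pM; rewrite ?cmod_ge0.
by rewrite cmodX lerXn2r ?nnegrE ?cmod_ge0 ?hM.
Qed.

(** The Cauchy inequality at centre [a] for the divided difference at [b]: where [|w - a| >= 1] one
    has [|w - b| >= 1/2], so the quotient is at most [2 M / (1/2)]. Discs of radius 2 about the
    centres used lie in the disc of radius 3. *)
Lemma cauchy_lipschitz f M a b :
  (forall w, cmod w <= 3 -> differentiable f w) ->
  (forall w, cmod w <= 3 -> cmod (f w) <= M) ->
  cmod a <= 4^-1 -> cmod b <= 4^-1 -> cmod (f a - f b) <= 4 * M * cmod (a - b).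
Proof.
move=> df fM a4 b4; have [->|ab] := eqVneq a b.
  by rewrite !subrr cmod0 mulr0.
have w3 w : cmod (w - a) <= 2 -> cmod w <= 3.
  by have := ler_cmod_sub w a; lra.
have f_dquot z : z != b -> f z - f b = dquot f b z * (z - b).
  by move=> zb; rewrite /dquot divfK // subr_eq0.
rewrite f_dquot // cmodM ler_wpM2r ?cmod_ge0 //.
apply: (cauchy_center ltr01 ab ab).
- by move=> w; rewrite mulr1 => wa wb _; apply/differentiable_dquot/wb/df/w3.
- by apply/dquot_locally_bounded/df; lra.
- by apply/dquot_locally_bounded/df; lra.
move=> w /andP[w1]; rewrite mulr1 => /w3 w2.
have wb : 2^-1 <= cmod (w - b).
  have := ler_cmod_sub (w - a) (b - a).
  have -> : w - a - (b - a) = w - b by ring.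
  have := ler_cmodB b a; lra.
rewrite cmodM cmodV ler_pdivrMr; last by lra.
have := fM w w2; have := fM b; have := ler_cmodB (f w) (f b).
have := cmod_ge0 (f w); nra.
Qed.

(** The quotient [k = (f - f 0) / w] is treated like [f] in the Lipschitz estimate: it is bounded by
    [4 M] away from 0, which gives [8 M / (1/2)]. As [k 0] is a junk value, [k z] is compared with
    [k y] for [y != 0], and [k y] tends to [l] as [y] tends to 0. *)
Lemma cauchy_quadratic f M l z :
  (forall w, cmod w <= 3 -> differentiable f w) ->
  (forall w, cmod w <= 3 -> cmod (f w) <= M) ->
  (forall e, 0 < e -> exists2 r, 0 < r & forall w, cmod w < r ->
    cmod (f w - f 0 - l * w) <= e * cmod w) ->
  cmod z <= 4^-1 -> cmod (f z - f 0 - l * z) <= 16 * M * cmod z ^+ 2.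
Proof.
move=> df fM fl z4; have [->|z0] := eqVneq z 0.
  by rewrite mulr0 !subrr cmod0 expr0n mulr0.
have zp : 0 < cmod z by rewrite cmod_gt0.
have M0 : 0 <= M by apply: le_trans (cmod_ge0 (f 0)) (fM 0 _); rewrite cmod0.
have w3 w : cmod (w - z) <= 2 -> cmod w <= 3.
  by have := ler_cmod_sub w z; lra.
pose k := dquot f 0.
have df0 : differentiable f 0 by apply: df; rewrite cmod0.
have step y : y != 0 -> cmod y <= 4^-1 -> z != y ->
    cmod (k z - k y) <= 16 * M * cmod (z - y).
  move=> y0 y4 zy.
  have yp : 0 < cmod y by rewrite cmod_gt0.
  have dy : differentiable f y by apply: df; lra.
  have ky : cmod (k y) <= 4 * M.
    rewrite /k /dquot cmodM cmodV ler_pdivrMr subr0 //.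
    by rewrite -[y in leRHS]subr0; apply: cauchy_lipschitz; rewrite ?cmod0.
  have -> : k z - k y = dquot k y z * (z - y).
    by rewrite /dquot divfK // subr_eq0.
  rewrite cmodM ler_wpM2r ?cmod_ge0 //.
  apply: (cauchy_center ltr01 z0 zy).
  - move=> w; rewrite mulr1 => wz w0 wy; apply: (differentiable_dquot _ wy).
    by apply/differentiable_dquot/w0/df/w3.
  - have [r [K [r0 rK]]] := dquot_locally_bounded df0.
    exists (Num.min r (cmod y / 2)), ((K + 4 * M) * 2 / cmod y).
    rewrite lt_min r0 divr_gt0 //; split=> // w.
    rewrite lt_min => /andP[/rK wK]; rewrite subr0 => wy.
    have wy2 : cmod y / 2 <= cmod (w - y).
      by have := ler_cmod_sub y w; rewrite cdistC; lra.
    rewrite cmodM cmodV ler_pdivrMr; last by lra.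
    apply: le_trans (ler_cmodB _ _) _.
    have -> : (K + 4 * M) * 2 / cmod y * cmod (w - y) =
      (K + 4 * M) * (cmod (w - y) / (cmod y / 2)) by field; rewrite gt_eqF.
    have : 1 <= cmod (w - y) / (cmod y / 2).
      by rewrite ler_pdivlMr ?mul1r // divr_gt0.
    have := cmod_ge0 (dquot f 0 w); rewrite -/(k w) in wK *; nra.
  - exact/dquot_locally_bounded/differentiable_dquot.
  move=> w /andP[w1]; rewrite mulr1 => /w3 w2.
  have wy : 2^-1 <= cmod (w - y).
    have := ler_cmod_sub (w - z) (y - z).
    have -> : w - z - (y - z) = w - y by ring.
    have := ler_cmodB y z; lra.
  have w34 : 3 / 4 <= cmod w by have := ler_cmodB w z; lra.
  have kw : cmod (k w) <= 4 * M.
    rewrite cmodM cmodV subr0 ler_pdivrMr; last by lra.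
    have := fM w w2; have := fM 0 ltac:(by rewrite cmod0).
    have := ler_cmodB (f w) (f 0); nra.
  rewrite cmodM cmodV ler_pdivrMr; last by lra.
  apply: le_trans (ler_cmodB _ _) _; nra.
have kE y : y != 0 -> f y - f 0 = k y * y.
  by move=> y0; rewrite /k /dquot subr0 divfK.
suff kl : cmod (k z - l) <= 16 * M * cmod z.
  by rewrite kE // -mulrBl cmodM expr2 mulrA ler_wpM2r ?cmod_ge0.
apply/ler_addgt0Pr => e e0; have e2 : 0 < e / 2 by rewrite divr_gt0.
have [r r0 rP] := fl _ e2.
(* The auxiliary point [y = t] is closer to 0 than [z], has [k y] within [e / 2] of [l], and costs
   at most [16 M t <= e / 2]. *)
pose t := Num.min (r / 2) (Num.min (cmod z / 2) (e / 2 / (16 * M + 1))).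
have M1 : 0 < 16 * M + 1 by lra.
have t0 : 0 < t by rewrite !lt_min !divr_gt0.
have tr : t < r by rewrite gt_min; apply/orP; left; lra.
have tz : t < cmod z.
  by rewrite !gt_min; apply/orP; right; apply/orP; left; lra.
have te : t * (16 * M + 1) <= e / 2.
  by rewrite -ler_pdivlMr // !ge_min lexx !orbT.
have yt : cmod (t%:C : R[i]) = t by rewrite cmod_real gtr0_norm.
have y0 : t%:C != 0 :> R[i] by rewrite -cmod_gt0 yt.
have zy : z != t%:C.
  by apply/negP => /eqP zt; move: tz; rewrite zt yt ltxx.
have y4 : cmod (t%:C : R[i]) <= 4^-1 by rewrite yt; lra.
have h1 := step _ y0 y4 zy.
have h2 : cmod (k t%:C - l) <= e / 2.
  have := rP t%:C; rewrite yt => /(_ tr); rewrite kE // -mulrBl cmodM yt.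
  by rewrite ler_pM2r.
have h3 := ler_cmodD (k z - k t%:C) (k t%:C - l).
have h4 := ler_cmodB z t%:C; rewrite yt in h4.
rewrite addrA subrK in h3.
have : 16 * M * cmod (z - t%:C) <= 16 * M * (cmod z + t).
  by rewrite ler_wpM2l // mulr_ge0.
nra.
Qed.

End DividedDifferences.

(** * Cauchy estimates in several variables *)

Section CauchyEstimates.
Context (R : realType) (m n : nat).
Notation Cm := 'rV[R[i]]_m.
Notation Cn := 'rV[R[i]]_n.
Implicit Types (f : Cm -> Cn) (z u h : Cm) (r M : R).

Lemma differentiable_slice f z u i (t : R[i]) : differentiable f (z + t *: u) ->
  differentiable (fun s : R[i] => f (z + s *: u) 0 i) t.
Proof.
move=> df.
have du : differentiable (fun s : R[i] => z + s *: u) t; last first.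
  have dfu : differentiable (f \o (fun s : R[i] => z + s *: u)) t.
    exact: differentiable_comp.
  exact: (differentiable_comp dfu (differentiable_coord _ 0 i)).
apply: (differentiableD (differentiable_cst z t)).
exact: (@differentiableZl _ _ _ id u t).
Qed.

(** Rescaling for the one-variable estimates: [t <= 1/4] puts [h] in their range, and [|u| = r / 4]
    keeps the slice over the disc of radius 3 inside the ball of radius [r]. *)
Lemma small_vector z h r : 0 < r -> rnorm h <= r / 16 -> h != 0 ->
  exists u t, [/\ h = t%:C *: u, rnorm u = r / 4, t = 4 * rnorm h / r,
    0 < t <= 4^-1 & forall s : R[i], cmod s <= 3 -> rnorm (z + s *: u - z) < r].
Proof.
move=> r0 hr h0; have hp : 0 < rnorm h by rewrite rnorm_gt0.
pose t := 4 * rnorm h / r.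
have t0 : 0 < t by rewrite divr_gt0 // mulr_gt0.
pose u := (t^-1)%:C *: h.
have ur : rnorm u = r / 4.
  rewrite rnormZ cmod_real gtr0_norm ?invr_gt0 // /t.
  by field; rewrite !gt_eqF.
exists u, t; split=> //.
- by rewrite scalerA -rmorphM /= divff ?gt_eqF // rmorph1 scale1r.
- by rewrite t0 /= /t ler_pdivrMr //; lra.
by move=> s s3; rewrite addrC addKr rnormZ ur; nra.
Qed.

Section Bounded.
Variables (f : Cm -> Cn) (z : Cm) (r M : R).
Hypotheses (r0 : 0 < r)
  (df : forall w, rnorm (w - z) < r -> differentiable f w)
  (fM : forall w, rnorm (w - z) < r -> rnorm (f w) <= M).

Let M0 : 0 <= M.
Proof.
by apply: le_trans (rnorm_ge0 _) (fM (w := z) _); rewrite subrr rnorm0.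
Qed.

(** Each coordinate is estimated on the complex line through [z] in direction [h]; since the norm is
    the maximum norm, the constants do not depend on the dimension. *)
Lemma holomorphic_lipschitz h : rnorm h <= r / 16 ->
  rnorm (f (z + h) - f z) <= 16 * M / r * rnorm h.
Proof.
move=> hr; have [->|h0] := eqVneq h 0.
  by rewrite addr0 subrr !rnorm0 mulr0.
have [u [t [hE ur tE /andP[t0 t4] inr]]] := small_vector z r0 hr h0.
apply: rnorm_coord_le => [|i].
  by rewrite mulr_ge0 ?rnorm_ge0 // divr_ge0 ?mulr_ge0 // ltW.
pose g s := f (z + s *: u) 0 i.
have dg s : cmod s <= 3 -> differentiable g s.
  by move=> /inr/df; exact: differentiable_slice.
have gM s : cmod s <= 3 -> cmod (g s) <= M.
  by move=> /inr/fM; apply: le_trans; exact: rnorm_coord.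
have := cauchy_lipschitz dg gM (a := t%:C) (b := 0).
rewrite subr0 cmod0 cmod_real gtr0_norm // invr_ge0 => /(_ t4 (ler0n _ _)).
rewrite /g scale0r addr0 -hE !mxE => H; apply: le_trans H _.
by rewrite tE; have -> : 16 * M / r * rnorm h = 4 * M * (4 * rnorm h / r) by ring.
Qed.

Lemma holomorphic_quadratic h : rnorm h <= r / 16 ->
  rnorm (f (z + h) - f z - 'd f z h) <= 256 * M / r ^+ 2 * rnorm h ^+ 2.
Proof.
move=> hr; have [->|h0] := eqVneq h 0.
  by rewrite addr0 linear0 !subrr !rnorm0 expr0n mulr0.
have [u [t [hE ur tE /andP[t0 t4] inr]]] := small_vector z r0 hr h0.
apply: rnorm_coord_le => [|i].
  apply: mulr_ge0; last by rewrite exprn_ge0 ?rnorm_ge0.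
  by apply: divr_ge0; [rewrite mulr_ge0 | exact/exprn_ge0/ltW].
pose g s := f (z + s *: u) 0 i.
have dg s : cmod s <= 3 -> differentiable g s.
  by move=> /inr/df; exact: differentiable_slice.
have gM s : cmod s <= 3 -> cmod (g s) <= M.
  by move=> /inr/fM; apply: le_trans; exact: rnorm_coord.
have up : 0 < rnorm u by rewrite ur divr_gt0.
have dl a : 'd f z (a *: u) = a *: 'd f z u by rewrite linearZ.
have gl e : 0 < e -> exists2 d, 0 < d & forall w, cmod w < d ->
    cmod (g w - g 0 - 'd f z u 0 i * w) <= e * cmod w.
  move=> e0; have eu : 0 < e / rnorm u by rewrite divr_gt0.
  have dfz : differentiable f z by apply: df; rewrite subrr rnorm0.
  have [d d0 dP] := differentiable_rnorm dfz eu.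
  exists (d / rnorm u); first by rewrite divr_gt0.
  move=> w; rewrite ltr_pdivlMr // => wd.
  have := dP (w *: u); rewrite rnormZ => /(_ wd).
  have -> : e / rnorm u * (cmod w * rnorm u) = e * cmod w.
    by field; rewrite gt_eqF.
  apply: le_trans; have -> : g w - g 0 - 'd f z u 0 i * w =
      (f (z + w *: u) - f z - 'd f z (w *: u)) 0 i.
    by rewrite /g scale0r addr0 dl !mxE [w * _]mulrC.
  exact: rnorm_coord.
have t4' : cmod (t%:C : R[i]) <= 4^-1 by rewrite cmod_real gtr0_norm.
have := cauchy_quadratic dg gM gl t4'; rewrite cmod_real gtr0_norm //.
have -> : 'd f z u 0 i * t%:C = 'd f z h 0 i.
  by rewrite hE dl !mxE mulrC.
rewrite /g scale0r addr0 -hE !mxE => H; apply: le_trans H _.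
have -> // : 256 * M / r ^+ 2 * rnorm h ^+ 2 = 16 * M * t ^+ 2.
by rewrite tE; field; rewrite gt_eqF.
Qed.

End Bounded.
End CauchyEstimates.

(** * Limits along an ultrafilter *)

Section UltraLimit.
Context (R : realType) (U : set_system nat) (UU : UltraFilter U).

(** Along an ultrafilter all bounded sequences in C^n converge simultaneously, so values and
    derivatives at all points have limits without extracting subsequences. This replaces Montel's
    theorem. *)
Definition ulim (V : normedModType R[i]) (x : nat -> V) (l : V) :=
  forall e, 0 < e -> \forall k \near U, rnorm (x k - l) < e.

Let PU : ProperFilter U := ultra_proper (F := U).

(** Compactness yields a cluster point, and a cluster point of an ultrafilter is a limit, because a
    set or its complement belongs to it. *)
Lemma ultra_real_cvg (x : nat -> R) (M : R) : (forall k, `|x k| <= M) ->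
  exists l, forall e, 0 < e -> \forall k \near U, `|x k - l| < e.
Proof.
move=> xM.
have xU : U (x @^-1` `[- M, M]).
  by apply: filterE => k /=; rewrite in_itv /= -ler_norml.
have [l [_ lP]] := @segment_compact R (- M) M (x @ U) _ xU.
exists l => e e0; have [//|nU] := in_ultra_setVsetC [set k | `|x k - l| < e] UU.
have [] := lP [set y | ~ `|y - l| < e] (ball l e) nU (nbhsx_ballx _ _ e0).
by move=> y [/= ye]; rewrite -ball_normE /= distrC.
Qed.

Lemma ulim_complex (x : nat -> R[i]) (M : R) : (forall k, cmod (x k) <= M) ->
  exists l, ulim x l.
Proof.
move=> xM.
have [a aP] := @ultra_real_cvg (fun k => complex.Re (x k)) M
  (fun k => le_trans (ler_Re_cmod _) (xM k)).
have [b bP] := @ultra_real_cvg (fun k => complex.Im (x k)) M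
  (fun k => le_trans (ler_Im_cmod _) (xM k)).
exists (a +i* b) => e e0; have e2 : 0 < e / 2 by rewrite divr_gt0.
apply: filterS2 (aP _ e2) (bP _ e2) => k ha hb.
apply: le_lt_trans (ler_cmod_ReIm _) _.
by case: (x k) ha hb => p q /=; lra.
Qed.

Lemma ulim_coord n (x : nat -> 'rV[R[i]]_n) (l : 'rV[R[i]]_n) :
  (forall i, ulim (fun k => x k 0 i) (l 0 i)) -> ulim x l.
Proof.
move=> H e e0; have e2 : 0 < e / 2 by rewrite divr_gt0.
have /filter_forall := fun i => H i _ e2; apply: filterS => k Hk.
apply: (@le_lt_trans _ _ (e / 2)); last by lra.
apply: rnorm_coord_le => [|i]; first exact: ltW.
by rewrite !mxE; exact: ltW (Hk i).
Qed.

Lemma ulim_row n (x : nat -> 'rV[R[i]]_n) (M : R) : (forall k, rnorm (x k) <= M) ->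
  exists l, ulim x l.
Proof.
move=> xM.
have /choice[l lP] i : exists a, ulim (fun k => x k 0 i) a.
  by apply: (@ulim_complex _ M) => k; apply: le_trans (rnorm_coord _ _) (xM k).
exists (\row_i l i); apply: ulim_coord => i.
by rewrite mxE; exact: lP.
Qed.

Lemma ulim_le (V : normedModType R[i]) (x : nat -> V) l (M : R) :
  ulim x l -> (\forall k \near U, rnorm (x k) <= M) -> rnorm l <= M.
Proof.
move=> xl xM; apply/ler_addgt0Pr => e e0.
have [k [h1 h2]] := filter_ex (filterI (xl _ e0) xM).
by have := ler_rnorm_sub l (x k); rewrite rdistC; lra.
Qed.

Lemma ulim_unique (V : normedModType R[i]) (x : nat -> V) l l' :
  ulim x l -> ulim x l' -> l = l'.
Proof.
move=> xl xl'; apply/eqP; rewrite -subr_eq0; apply/eqP/rnorm_eq0/eqP.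
rewrite eq_le rnorm_ge0 andbT; apply/ler_addgt0Pr => e e0; rewrite add0r.
have e2 : 0 < e / 2 by rewrite divr_gt0.
have [k [h1 h2]] := filter_ex (filterI (xl _ e2) (xl' _ e2)).
have := ler_rdistD (x k) l l'; rewrite [rnorm (l - x k)]rdistC; lra.
Qed.

Lemma ulimD (V : normedModType R[i]) (x y : nat -> V) l m :
  ulim x l -> ulim y m -> ulim (fun k => x k + y k) (l + m).
Proof.
move=> xl ym e e0; have e2 : 0 < e / 2 by rewrite divr_gt0.
apply: filterS2 (xl _ e2) (ym _ e2) => k h1 h2; rewrite opprD addrACA.
by have := ler_rnormD (x k - l) (y k - m); lra.
Qed.

Lemma ulimZ (V : normedModType R[i]) (a : R[i]) (x : nat -> V) l :
  ulim x l -> ulim (fun k => a *: x k) (a *: l).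
Proof.
move=> xl e e0; have a1 : 0 < cmod a + 1 by rewrite ltr_wpDl ?cmod_ge0.
apply: filterS (xl _ (divr_gt0 e0 a1)) => k; rewrite ltr_pdivlMr // => h.
rewrite -scalerBr rnormZ; have := rnorm_ge0 (x k - l); lra.
Qed.

Lemma ulim_cst (V : normedModType R[i]) (l : V) : ulim (fun=> l) l.
Proof. by move=> e e0; apply: filterE => k; rewrite subrr rnorm0. Qed.

Lemma ulim_continuous (V W : normedModType R[i]) (f : V -> W) x l :
  {for l, continuous f} -> ulim x l -> ulim (fun k => f (x k)) (f l).
Proof.
move=> fc xl e e0; have [r r0 rP] := continuous_rnorm fc e0.
by apply: filterS (xl _ r0) => k /rP.
Qed.

Lemma ulim_near (V : normedModType R[i]) (x y : nat -> V) l :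
  ulim x l -> ulim (fun k => x k - y k) 0 -> ulim y l.
Proof.
move=> xl xy; have := ulimD xl (ulimZ (-1) xy); rewrite scaler0 addr0.
by under eq_fun do rewrite scaleN1r opprB addrC subrK.
Qed.

End UltraLimit.

(** * Limits of holomorphic maps *)

Section HolomorphicLimits.
Context (R : realType) (n : nat).
Notation Cn := 'rV[R[i]]_n.
Implicit Types (Omega : set Cn) (M r : R).

(** The transfer condition is symmetric in [w] and [w']: from the centre outwards it makes the set
    where [A] holds relatively open, from nearby points to the centre relatively closed. *)
Lemma connected_locally_constant Omega (A : Cn -> Prop) z0 :
  open Omega -> connected Omega -> Omega z0 -> A z0 ->
  (forall z, Omega z -> exists2 r, 0 < r & forall w w', Omega w -> Omega w' ->
    rnorm (w - z) < r -> rnorm (w' - z) < r -> A w -> A w') ->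
  forall z, Omega z -> A z.
Proof.
move=> oO cO Oz0 Az0 H.
have E : Omega `&` A = Omega.
  apply: cO; first by exists z0.
    exists (Omega `&` A); last by rewrite setIA setIid.
    apply/open_rnormP => x [Ox Ax]; have [r r0 rP] := H x Ox.
    have [e e0 eP] := (open_rnormP Omega).1 oO x Ox.
    exists (Num.min r e); first by rewrite lt_min r0.
    move=> y; rewrite lt_min => /andP[yr /eP Oy]; split => //.
    by apply: (rP x y) => //; rewrite subrr rnorm0.
  exists (closure (Omega `&` A)); first exact: closed_closure.
  apply/seteqP; split=> x [Ox Ax]; first by split=> //; exact: subset_closure.
  split=> //; have [r r0 rP] := H x Ox.
  have [|y [[Oy Ay] yr]] := Ax [set y | rnorm (y - x) < r].
    by apply/nbhs_rnormP; exists r.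
  by apply: (rP y x) => //; rewrite subrr rnorm0.
by move=> z; rewrite -{1}E => -[].
Qed.

Lemma holomorphic_lipschitz_near Omega z : open Omega -> Omega z ->
  exists2 r, 0 < r & forall (f : Cn -> Cn) M, holomorphic_on Omega f ->
    (forall w, Omega w -> rnorm (f w) <= M) ->
    forall w w', rnorm (w - z) < r -> rnorm (w' - z) < r ->
    rnorm (f w' - f w) <= 16 * M / r * rnorm (w' - w).
Proof.
move=> oO Oz; have [e e0 eP] := (open_rnormP Omega).1 oO z Oz.
(* Two points within [e / 64] of [z] differ by at most [(e / 2) / 16], the range of the Lipschitz
   estimate on a ball of radius [e / 2] inside [Omega]. *)
have r0 : 0 < e / 64 by rewrite divr_gt0.
exists (e / 64) => // f M hf fM w w' wz w'z.
have M0 : 0 <= M by apply: le_trans (rnorm_ge0 _) (fM z Oz).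
have Ow x : rnorm (x - w) < e / 2 -> Omega x.
  by move=> xw; apply: eP; have := ler_rdistD w x z; lra.
have ww : rnorm (w' - w) <= e / 2 / 16.
  by have := ler_rdistD z w' w; rewrite [rnorm (z - w)]rdistC; lra.
have e2 : 0 < e / 2 by rewrite divr_gt0.
have := holomorphic_lipschitz e2 (fun x xw => hf x (Ow x xw))
  (fun x xw => fM x (Ow x xw)) ww.
rewrite [w + _]addrC subrK => H; apply: le_trans H _.
rewrite ler_wpM2r ?rnorm_ge0 // ler_wpM2l ?mulr_ge0 // lef_pV2 ?posrE //; lra.
Qed.

Context (U : set_system nat) (UU : UltraFilter U).
Let PU : ProperFilter U := ultra_proper (F := U).

(** The differentials at [z] are uniformly bounded, so they have a limit [L], and the quadratic
    remainder bound, uniform in [k], passes to the limit. *)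
Lemma ulim_holomorphic Omega (f : nat -> Cn -> Cn) (F : Cn -> Cn) M :
  open Omega -> (forall k, holomorphic_on Omega (f k)) ->
  (forall k z, Omega z -> rnorm (f k z) <= M) ->
  (forall z, Omega z -> ulim U (f ^~ z) (F z)) -> holomorphic_on Omega F.
Proof.
move=> oO hf fM fF z Oz.
have [r r0 rP] := (open_rnormP Omega).1 oO z Oz.
have M0 : 0 <= M by apply: le_trans (rnorm_ge0 _) (fM 0%N z Oz).
have lip k h (hr : rnorm h <= r / 16) := holomorphic_lipschitz r0
  (fun x xz => hf k x (rP x xz)) (fun x xz => fM k x (rP x xz)) hr.
have quad k h (hr : rnorm h <= r / 16) := holomorphic_quadratic r0
  (fun x xz => hf k x (rP x xz)) (fun x xz => fM k x (rP x xz)) hr.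
(* For [|h| = r / 16] the Lipschitz and quadratic bounds both equal [M], so the differential is at
   most [2 M] there; homogeneity gives [C]. *)
pose C := 32 * M / r.
have LC k h : rnorm ('d (f k) z h) <= C * rnorm h.
  have [->|h0] := eqVneq h 0; first by rewrite linear0 !rnorm0 mulr0.
  have hp : 0 < rnorm h by rewrite rnorm_gt0.
  pose t := r / 16 / rnorm h.
  have t0 : 0 < t by rewrite !divr_gt0.
  have ur : rnorm (t%:C *: h) = r / 16.
    by rewrite rnormZ cmod_real gtr0_norm // divfK // gt_eqF.
  have := lip k (t%:C *: h); have := quad k (t%:C *: h).
  rewrite ur lexx => /(_ isT) h1 /(_ isT) h2.
  have {}h1 : rnorm (f k (z + t%:C *: h) - f k z - 'd (f k) z (t%:C *: h)) <= M.
    by apply: le_trans h1 _; rewrite le_eqVlt; apply/orP; left; apply/eqP;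
      field; rewrite gt_eqF.
  have {}h2 : rnorm (f k (z + t%:C *: h) - f k z) <= M.
    by apply: le_trans h2 _; rewrite le_eqVlt; apply/orP; left; apply/eqP;
      field; rewrite gt_eqF.
  have : rnorm ('d (f k) z (t%:C *: h)) <= 2 * M.
    have := ler_rnorm_sub ('d (f k) z (t%:C *: h)) (f k (z + t%:C *: h) - f k z).
    by rewrite rdistC; lra.
  rewrite linearZ /= rnormZ cmod_real gtr0_norm // -ler_pdivlMl // => H.
  apply: le_trans H _; rewrite le_eqVlt; apply/orP; left; apply/eqP.
  by rewrite /t /C; field; rewrite !gt_eqF.
have /choice[L LP] h : exists l, ulim U (fun k => 'd (f k) z h) l.
  exact: (@ulim_row _ _ UU _ _ (C * rnorm h)).
have Ll : linear L.
  move=> a u v; apply: (ulim_unique UU (LP _)).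
  have := ulimD UU (ulimZ UU a (LP u)) (LP v).
  by under eq_fun do rewrite -linearP.
pose LM := GRing.isLinear.Build _ _ _ _ L Ll.
pose LL : {linear Cn -> Cn} := HB.pack L LM.
apply: (@rnorm_differentiable _ _ _ _ _ LL C) => [h|e e0].
  by apply: (ulim_le UU (LP h)); apply: filterE => k; exact: LC.
pose D := 256 * M / r ^+ 2.
have D0 : 0 <= D.
  by apply: divr_ge0; [rewrite mulr_ge0 | exact/exprn_ge0/ltW].
exists (Num.min (r / 16) (e / (D + 1))).
  by rewrite lt_min !divr_gt0 // ltr_wpDl.
move=> h; rewrite lt_min => /andP[hr]; rewrite ltr_pdivlMr ?ltr_wpDl // => he.
apply: (@le_trans _ _ (D * rnorm h ^+ 2)).
  have Ozh : Omega (z + h) by apply: rP; rewrite addrC addKr; lra.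
  have H := ulimD UU (ulimD UU (fF _ Ozh) (ulimZ UU (-1) (fF z Oz)))
    (ulimZ UU (-1) (LP h)).
  rewrite !scaleN1r in H; apply: (ulim_le UU H); apply: filterE => k.
  by rewrite !scaleN1r; apply: quad; exact: ltW.
rewrite expr2 mulrA ler_wpM2r ?rnorm_ge0 //; have := rnorm_ge0 h; lra.
Qed.

Lemma ulim_equicontinuous Omega (f : nat -> Cn -> Cn) (x : nat -> Cn) z M :
  open Omega -> (forall k, holomorphic_on Omega (f k)) ->
  (forall k z, Omega z -> rnorm (f k z) <= M) ->
  Omega z -> ulim U x z -> ulim U (fun k => f k (x k) - f k z) 0.
Proof.
move=> oO hf fM Oz xz e e0.
have [r r0 rP] := holomorphic_lipschitz_near oO Oz.
have M0 : 0 <= M by apply: le_trans (rnorm_ge0 _) (fM 0%N z Oz).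
have C0 : 0 < 16 * M / r + 1 by rewrite ltr_wpDl // divr_ge0 ?mulr_ge0 // ltW.
apply: filterS2 (xz _ r0) (xz _ (divr_gt0 e0 C0)) => k xr.
rewrite ltr_pdivlMr // subr0 => xe.
have := rP _ _ (hf k) (fM k) z (x k); rewrite subrr rnorm0 => /(_ r0 xr).
have := rnorm_ge0 (x k - z); lra.
Qed.

(** The inverse is kept as data because limits of the maps and of their inverses are taken
    together. *)
Definition automorphism_pair Omega (f g : Cn -> Cn) :=
  [/\ holomorphic_on Omega f /\ holomorphic_on Omega g,
      forall z, Omega z -> Omega (f z), forall z, Omega z -> Omega (g z),
      forall z, Omega z -> g (f z) = z & forall z, Omega z -> f (g z) = z].

Lemma homogeneous_pair Omega z w : homogeneous Omega -> Omega z -> Omega w ->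
  exists f g, automorphism_pair Omega f g /\ f z = w.
Proof.
move=> hO Oz Ow; have [f [hf [fO _ _] [g [hg gO gf fg]]] fz] := hO z w Oz Ow.
by exists f, g.
Qed.

Lemma holomorphic_comp Omega (f g : Cn -> Cn) : holomorphic_on Omega f ->
  (forall z, Omega z -> Omega (f z)) -> holomorphic_on Omega g ->
  holomorphic_on Omega (g \o f).
Proof.
move=> hf fO hg z Oz.
by have := differentiable_comp (hf z Oz) (hg _ (fO z Oz)).
Qed.

(* Homogeneity transports the image of a point to the centre 0, where all
   bounded holomorphic maps are uniformly Lipschitz. Hence a limit of self-maps
   stays inside Omega near every point whose image is inside. *)
Lemma ulim_self_map Omega (f : nat -> Cn -> Cn) (F : Cn -> Cn) M z0 :
  open Omega -> connected Omega -> Omega 0 -> homogeneous Omega ->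
  (forall z, Omega z -> rnorm z <= M) ->
  (forall k, holomorphic_on Omega (f k)) ->
  (forall k z, Omega z -> Omega (f k z)) ->
  (forall z, Omega z -> ulim U (f ^~ z) (F z)) -> Omega z0 -> Omega (F z0) ->
  forall z, Omega z -> Omega (F z).
Proof.
move=> oO cO O0 hO OM hf fO fF Oz0 OFz0.
apply: (connected_locally_constant (A := fun z => Omega (F z)) oO cO Oz0 OFz0).
move=> z Oz; have [r r0 rP] := holomorphic_lipschitz_near oO Oz.
have M0 : 0 <= M by apply: le_trans (rnorm_ge0 _) (OM 0 O0).
have [e e0 eP] := (open_rnormP Omega).1 oO 0 O0.
have C0 : 0 < 16 * M / r + 1 by rewrite ltr_wpDl // divr_ge0 ?mulr_ge0 // ltW.
pose d := Num.min r (e / 8 / (16 * M / r + 1)).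
exists d; first by rewrite lt_min r0 !divr_gt0.
move=> w w' Ow Ow'; rewrite !lt_min !ltr_pdivlMr //.
move=> /andP[wr we] /andP[w'r w'e] OFw.
(* [g] depends on [w], but every [g \o f k] is still bounded by [M] on [Omega]; so one Lipschitz
   constant near [z] serves all [w], and [d] can be fixed in advance. *)
have [g [g' [[[hg hg'] gO g'O g'g gg'] gw]]] := homogeneous_pair hO OFw O0.
pose x k := g (f k w').
have xM k : rnorm (x k) <= M by apply/OM/gO/fO.
have [v xv] := ulim_row UU xM.
have gfw : ulim U (fun k => g (f k w)) 0.
  rewrite -gw; apply: (@ulim_continuous _ _ UU) (fF w Ow).
  exact/differentiable_continuous/hg.
have close k : rnorm (x k - g (f k w)) <= e / 4.
  have hgf := holomorphic_comp (hf k) (fO k) hg.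
  have gfM y : Omega y -> rnorm ((g \o f k) y) <= M by move=> ?; apply/OM/gO/fO.
  apply: le_trans (rP _ _ hgf gfM w w' wr w'r) _.
  have := ler_rdistD z w' w; rewrite [rnorm (z - w)]rdistC.
  have : 0 <= 16 * M / r by rewrite divr_ge0 ?mulr_ge0 // ltW.
  have := rnorm_ge0 (w - z); have := rnorm_ge0 (w' - z); nra.
have Ov : Omega v.
  apply: eP; rewrite subr0; apply: (@le_lt_trans _ _ (e / 2)); last by lra.
  apply: (ulim_le UU xv); have e4 : 0 < e / 4 by rewrite divr_gt0.
  apply: filterS (gfw _ e4) => k; rewrite subr0 => h.
  have := ler_rnorm_sub (x k) (g (f k w)); have := close k; lra.
have g'x : ulim U (fun k => g' (x k)) (g' v).
  apply: (@ulim_continuous _ _ UU) xv; exact/differentiable_continuous/hg'.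
have -> : F w' = g' v.
  apply: (ulim_unique UU (fF w' Ow')).
  have <- : (fun k => g' (x k)) = f^~ w'; last exact: g'x.
  by apply/funext => k; rewrite /x g'g //; exact: fO.
exact: g'O.
Qed.

End HolomorphicLimits.

(** * Convex d-balanced domains *)

Section ConvexBalanced.
Context (R : realType) (n : nat).
Notation Cn := 'rV[R[i]]_n.
Implicit Types (Omega : set Cn) (d : 'I_n -> nat).

Lemma ultrafilter_nat_exists : exists U : set_system nat,
  UltraFilter U /\ forall K, \forall k \near U, (K <= k)%N.
Proof.
have [U [UU HU]] := @ultraFilterLemma nat \oo _.
by exists U; split=> // K; apply: HU; exists K.
Qed.

Lemma near_exprn_half_lt (U : set_system nat) (e : R) : Filter U ->
  (forall K, \forall k \near U, (K <= k)%N) -> 0 < e ->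
  \forall k \near U, 2^-1 ^+ k < e.
Proof.
move=> UF HU /exprn_half_lt[m me]; apply: filterS (HU m) => k mk.
apply: le_lt_trans me; apply: ler_wiXn2l; rewrite ?invr_ge0 //.
by rewrite invf_le1 // ler1n.
Qed.

Lemma convex_in_Cn_comb Omega (p : R) x y : convex_in_Cn Omega -> 0 <= p <= 1 ->
  Omega x -> Omega y -> Omega (p%:C *: x + (1 - p%:C) *: y).
Proof.
move=> cO p01 Ox Oy.
have pC : (0 : R[i]) <= p%:C <= 1.
  by rewrite ler0c -[1](rmorph1 (real_complex R)) lecR.
have := cO x y (Itv01 (andP pC).1 (andP pC).2).
by rewrite !inE => /(_ Ox Oy).
Qed.

Lemma convex_in_Cn_mean Omega N (p : 'I_N.+1 -> Cn) : convex_in_Cn Omega ->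
  (forall k, Omega (p k)) -> Omega (N.+1%:R^-1 *: \sum_k p k).
Proof.
move=> cO; elim: N p => [|N IH] p Op.
  by rewrite big_ord_recl big_ord0 addr0 invr1 scale1r.
pose a : R := N.+2%:R^-1.
have aC : a%:C = N.+2%:R^-1 by rewrite fmorphV /= rmorph_nat.
have a01 : 0 <= a <= 1 by rewrite invr_ge0 ler0n /= invf_le1 // ler1n.
have -> : N.+2%:R^-1 *: \sum_k p k = a%:C *: p ord0 +
    (1 - a%:C) *: (N.+1%:R^-1 *: \sum_k p (lift ord0 k)).
  rewrite aC big_ord_recl scalerDr scalerA; congr (_ + _ *: _).
  have n1 : N.+1%:R != 0 :> R[i] by rewrite pnatr_eq0.
  have n2 : N.+2%:R != 0 :> R[i] by rewrite pnatr_eq0.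
  apply: (mulIf n1); rewrite divfK //; apply: (mulfI n2).
  by rewrite mulrA divff // mul1r mulrBr divff // mulr1 -[in RHS]natr1 addrK.
by apply: convex_in_Cn_comb => //; apply: IH => k; exact: Op.
Qed.

Lemma primitive_root_exists N : (0 < N)%N ->
  exists w : R[i], N.-primitive_root w.
Proof.
pose p : {poly R[i]} := 'X^N - 1; have [r Dp] := closed_field_poly_normal p.
move=> N0; rewrite (monicP _) ?monicXnsubC // scale1r in Dp.
have rn1 : all N.-unity_root r.
  by apply/allP => z; rewrite -root_prod_XsubC -Dp.
have sz_r : (N < (size r).+1)%N.
  by rewrite -(size_prod_XsubC r id) -Dp size_XnsubC.
have [|z] := hasP (has_prim_root N0 rn1 _ sz_r); last by exists z.
by rewrite -separable_prod_XsubC -Dp separable_Xn_sub_1 // pnatr_eq0 -lt0n.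
Qed.

Lemma sum_prim_root_expr N (w : R[i]) j : N.-primitive_root w ->
  (0 < j < N)%N -> \sum_(k < N) (w ^+ k) ^+ j = 0.
Proof.
move=> pw /andP[j0 jN].
have wj : w ^+ j - 1 != 0.
  rewrite subr_eq0 -(prim_order_dvd pw); apply/negP => /dvdn_leq.
  by rewrite j0 leqNgt jN => /(_ isT).
apply: (mulfI wj); rewrite mulr0.
have -> : \sum_(k < N) (w ^+ k) ^+ j = \sum_(k < N) (w ^+ j) ^+ k.
  by apply: eq_bigr => k _; rewrite -!exprM mulnC.
by rewrite -subrX1 -exprM mulnC exprM (prim_expr_order pw) // expr1n subrr.
Qed.

(** The mean value property of polynomials, exact on [N] equidistant points of a circle as long as
    the degree is below [N]. *)
Lemma prim_root_mean_value N (w s t : R[i]) m : N.-primitive_root w ->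
  (m < N)%N -> \sum_(k < N) (s + t * w ^+ k) ^+ m = N%:R * s ^+ m.
Proof.
move=> pw mN.
under eq_bigr do rewrite exprDn.
rewrite exchange_big /= big_ord_recl /=.
rewrite [X in _ + X]big1 ?addr0 => [|j _].
  under eq_bigr do rewrite subn0 bin0 expr0 mulr1.
  by rewrite sumr_const card_ord mulr1n mulr_natl.
rewrite sumrMnl -mulr_sumr.
under eq_bigr do rewrite exprMn.
rewrite -mulr_sumr sum_prim_root_expr ?mulr0 ?mul0rn //=.
rewrite /bump /= add1n; apply: leq_trans mN; exact: ltn_ord.
Qed.

Definition wscale d (t : R[i]) (x : Cn) : Cn := \row_i (t ^+ d i * x 0 i).

Lemma wscaleM d s t x : wscale d s (wscale d t x) = wscale d (s * t) x.
Proof. by apply/rowP => i; rewrite !mxE exprMn mulrA. Qed.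

Lemma wscale1 d x : wscale d 1 x = x.
Proof. by apply/rowP => i; rewrite !mxE expr1n mul1r. Qed.

Lemma wscaleK d s x : s != 0 -> wscale d s (wscale d s^-1 x) = x.
Proof. by move=> s0; rewrite wscaleM divff // wscale1. Qed.

Lemma wscaleB d s x y : wscale d s (x - y) = wscale d s x - wscale d s y.
Proof. by apply/rowP => i; rewrite !mxE mulrBr. Qed.

Lemma wscale0 d x : (forall i, (0 < d i)%N) -> wscale d 0 x = 0.
Proof. by move=> d0; apply/rowP => i; rewrite !mxE expr0n eqn0Ngt d0 mul0r. Qed.

Lemma rnorm_wscale_le d t x : cmod t <= 1 -> rnorm (wscale d t x) <= rnorm x.
Proof.
move=> t1; apply: rnorm_coord_le => [|i]; first exact: rnorm_ge0.
rewrite mxE cmodM cmodX; apply: le_trans (rnorm_coord x i).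
by rewrite ler_piMl ?cmod_ge0 // exprn_ile1 ?cmod_ge0.
Qed.

Section WscaleLimit.
Context (U : set_system nat) (UU : UltraFilter U).
Let PU : ProperFilter U := ultra_proper (F := U).

Lemma ulim_coordE (x : nat -> Cn) (l : Cn) i : ulim U x l ->
  ulim U (fun k => x k 0 i) (l 0 i).
Proof.
move=> xl e e0; apply: filterS (xl e e0) => k; apply: le_lt_trans.
by have := rnorm_coord (x k - l) i; rewrite !mxE.
Qed.

Lemma ulimM (x y : nat -> R[i]) (a b : R[i]) : ulim U x a -> ulim U y b ->
  ulim U (fun k => x k * y k) (a * b).
Proof.
move=> xa yb e e0.
have b1 : 0 < cmod b + 1 by rewrite ltr_wpDl ?cmod_ge0.
have a1 : 0 < cmod a + 1 by rewrite ltr_wpDl ?cmod_ge0.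
have eb : 0 < e / 2 / (cmod b + 1) by rewrite !divr_gt0.
have ea : 0 < e / 2 / (cmod a + 1) by rewrite !divr_gt0.
apply: filterS3 (xa _ eb) (yb _ ea) (yb 1 ltr01) => k.
rewrite !ltr_pdivlMr // -![rnorm _]/(cmod _) => h1 h2 h3.
have -> : x k * y k - a * b = (x k - a) * y k + a * (y k - b) by ring.
apply: le_lt_trans (ler_cmodD _ _) _; rewrite !cmodM.
have := ler_cmod_sub (y k) b; have := cmod_ge0 (x k - a).
have := cmod_ge0 (y k - b); have := cmod_ge0 a; nra.
Qed.

Lemma ulimX (x : nat -> R[i]) (a : R[i]) m : ulim U x a ->
  ulim U (fun k => x k ^+ m) (a ^+ m).
Proof.
move=> xa; elim: m => [|m IH]; first exact: ulim_cst.
by rewrite exprS; under eq_fun do rewrite exprS; exact: ulimM.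
Qed.

Lemma ulim_wscale d (t : nat -> R[i]) (s : R[i]) (x : nat -> Cn) (l : Cn) :
  ulim U t s -> ulim U x l -> ulim U (fun k => wscale d (t k) (x k)) (wscale d s l).
Proof.
move=> ts xl; apply: ulim_coord => i.
rewrite mxE; under eq_fun do rewrite mxE.
by apply: ulimM; [exact: ulimX | exact: ulim_coordE].
Qed.

Lemma ulim_open Omega (x : nat -> Cn) (l : Cn) : open Omega -> Omega l ->
  ulim U x l -> \forall k \near U, Omega (x k).
Proof.
move=> oO Ol xl; have [r r0 rP] := (open_rnormP Omega).1 oO l Ol.
by apply: filterS (xl r r0) => k /rP.
Qed.

End WscaleLimit.

Lemma open_wscale d Omega (s : R[i]) x : open Omega -> Omega (wscale d s x) ->
  exists2 r, 0 < r & forall t, cmod (t - s) < r -> Omega (wscale d t x).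
Proof.
move=> oO Os; apply: contrapT => /forall2NP H.
have [U [UU HU]] := ultrafilter_nat_exists.
have PU : ProperFilter U := ultra_proper (F := U).
have /choice[t tP] k : exists t : R[i],
    cmod (t - s) < 2^-1 ^+ k /\ ~ Omega (wscale d t x).
  have [/negP|] := H (2^-1 ^+ k); first by rewrite exprn_gt0 // invr_gt0.
  by move=> /existsNP[t /not_implyP[? ?]]; exists t.
have ts : ulim U t s.
  move=> e e0; apply: filterS (near_exprn_half_lt _ HU e0) => k.
  by apply: lt_trans; exact: (tP k).1.
have tO := ulim_open UU oO Os (ulim_wscale UU d ts (ulim_cst UU x)).
by have [k /(tP k).2] := filter_ex tO.
Qed.

Lemma wscale_shrink d Omega x (s t : R) : d_balanced d Omega ->
  0 <= s <= t -> Omega (wscale d t%:C x) -> Omega (wscale d s%:C x).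
Proof.
move=> bO /andP[s0 st]; have [tz|tp] := eqVneq t 0.
  by have -> : s = t by apply/eqP; rewrite eq_le st tz.
have t0 : 0 < t by rewrite lt_neqAle eq_sym tp (le_trans s0).
have -> : s%:C = (s / t)%:C * t%:C :> R[i] by rewrite -rmorphM /= divfK.
rewrite -wscaleM => Ot; apply: bO => //.
rewrite cmodE cmod_real -[1](rmorph1 (real_complex R)) lecR.
by rewrite ger0_norm ?divr_ge0 ?(ltW t0) // ler_pdivrMr // mul1r.
Qed.

(* By the mean value property on the circle around s through s - tau, the point
   s^d x is a mean of points of the closure of Omega, one of them interior. *)
Lemma wscale_mean_value d Omega x (s tau : R) : open Omega ->
  convex_in_Cn Omega -> d_balanced d Omega ->
  (forall e, 0 < e -> exists2 y, Omega y & rnorm (y - x) < e) ->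
  0 < tau <= s -> s + tau <= 1 -> Omega (wscale d (s - tau)%:C x) ->
  Omega (wscale d s%:C x).
Proof.
move=> oO cO bO clx /andP[tau0 taus] st1 Op0; have sp := lt_le_trans tau0 taus.
have [e e0 eP] := (open_rnormP Omega).1 oO _ Op0.
(* [N] exceeds every weight, so the discrete mean value property holds in each coordinate. *)
pose N' := (\sum_i d i)%N; pose N := N'.+1.
have dN i : (d i < N)%N by rewrite ltnS /N' (bigD1 i) //= leq_addr.
have [w pw] := primitive_root_exists (ltn0Sn N').
have w1 : cmod w = 1.
  have /eqP := congr1 (@cmod R) (prim_expr_order pw).
  by rewrite cmodX cmod1 pexpr_eq1 ?cmod_ge0 // => /eqP.
have [x' Ox' xx'] := clx (e / N%:R) (divr_gt0 e0 (ltr0Sn _ _)).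
pose z k : R[i] := s%:C + (- tau)%:C * w ^+ k.
have z1 k : cmod (z k) <= 1.
  apply: le_trans (ler_cmodD _ _) _.
  rewrite cmodM cmodX w1 expr1n mulr1 !cmod_real normrN !gtr0_norm //; lra.
(* [x] itself may lie on the boundary, so for [k != 0] it is replaced by a nearby [x'] in [Omega].
   The total error is charged to the term [k = 0], the interior point [(s - tau)^d x], leaving the
   mean unchanged. *)
pose p (k : 'I_N) := wscale d (z k) x + (if k == ord0 then
  \sum_(j < N') (wscale d (z (lift ord0 j)) x - wscale d (z (lift ord0 j)) x')
  else wscale d (z k) x' - wscale d (z k) x).
have -> : wscale d s%:C x = N%:R^-1 *: \sum_k p k.
  rewrite big_split /= [X in _ + X]big_ord_recl /= -big_split /=.
  rewrite [X in _ + X]big1 ?addr0 => [|j _]; last first.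
    by rewrite addrA subrK subrr.
  apply/rowP => i; rewrite !mxE summxE.
  under eq_bigr do rewrite mxE.
  rewrite -mulr_suml prim_root_mean_value // !mulrA mulVf ?mul1r //.
  by rewrite pnatr_eq0.
apply: convex_in_Cn_mean => // k; rewrite /p; case: eqP => [->|_]; last first.
  rewrite addrC subrK; apply: bO => //.
  by rewrite cmodE -[1](rmorph1 (real_complex R)) lecR.
apply: eP; rewrite [z _]/z expr0 mulr1 -rmorphD /= addrAC subrr add0r.
apply: le_lt_trans (ler_rnorm_sum _ _ _) _.
apply: (@le_lt_trans _ _ (\sum_(j < N') rnorm (x' - x))).
  apply: ler_sum => j _; rewrite -wscaleB rdistC.
  exact: rnorm_wscale_le.
rewrite sumr_const card_ord -mulr_natr; move: xx'; rewrite ltr_pdivlMr //.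
have := rnorm_ge0 (x' - x); rewrite /N -natr1; have := ler0n R N'; nra.
Qed.

(** The [t] with [t^d x] in [Omega] fill an interval from 0. If [t0] were missing, the supremum [s]
    would be below 1; the mean value lemma puts [s] itself in the set, and openness of [Omega] then
    a larger parameter. *)
Lemma wscale_closure d Omega x t0 : open Omega -> convex_in_Cn Omega ->
  d_balanced d Omega -> (forall i, (0 < d i)%N) ->
  (forall e, 0 < e -> exists2 y, Omega y & rnorm (y - x) < e) ->
  0 <= t0 < 1 -> Omega (wscale d t0%:C x).
Proof.
move=> oO cO bO d0 clx /andP[t00 t01].
pose T := [set t : R | 0 <= t /\ Omega (wscale d t%:C x)].
have T0 : T 0.
  split; first exact: lexx; have [y Oy _] := clx 1 ltr01.
  rewrite (rmorph0 (real_complex R)) wscale0 // -(wscale0 y d0).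
  by apply: (bO y 0 Oy); rewrite normr0.
apply: contrapT => nO.
have ubT : ubound T t0.
  move=> t [_ Ot]; rewrite leNgt; apply/negP => tt0; apply: nO.
  by apply: (wscale_shrink bO _ Ot); rewrite t00 ltW.
clear nO; pose s := sup T.
have hT : has_sup T by split; [exists 0 | exists t0].
have st0 : s <= t0 by apply: ge_sup ubT; exists 0.
have s0 : 0 <= s by apply: ub_le_sup T0; exists t0.
have Os : Omega (wscale d s%:C x).
  have [->|sn0] := eqVneq s 0; first exact: T0.2.
  have sp : 0 < s by rewrite lt_neqAle eq_sym sn0.
  (* The largest radius for which [s - tau >= 0] and the circle around [s] stays in the unit
     disc. *)
  pose tau := Num.min s (1 - s).
  have tau0 : 0 < tau by rewrite lt_min sp; lra.
  have taus : tau <= s by rewrite ge_min lexx.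
  have tau1 : tau <= 1 - s by rewrite ge_min lexx orbT.
  apply: (@wscale_mean_value _ _ _ _ tau oO cO bO clx); [by rewrite tau0 | lra |].
  have [t [_ Ot] st] := sup_adherent tau0 hT.
  by apply: (wscale_shrink bO _ Ot); rewrite subr_ge0 taus ltW.
have [r r0 /(_ (s + r / 2)%:C)] := open_wscale oO Os.
rewrite -rmorphB /= cmod_real addrAC subrr add0r.
rewrite ger0_norm ?divr_ge0 ?(ltW r0) //; have -> : r / 2 < r by lra.
move=> /(_ isT) Or.
have : s + r / 2 <= s.
  by apply: ub_le_sup; [exists t0 | split; [lra | exact: Or]].
lra.
Qed.

End ConvexBalanced.

(** * Automorphisms near the identity *)

Section NearIdentity.
Context (R : realType) (n : nat).
Notation Cn := 'rV[R[i]]_n.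
Variables (d : 'I_n -> nat) (Omega : set Cn) (M : R).
Hypotheses (d0 : forall i, (0 < d i)%N) (oO : open Omega) (O0 : Omega 0)
  (OM : forall z, Omega z -> rnorm z <= M) (cO : convex_in_Cn Omega)
  (bO : d_balanced d Omega).

Lemma wscale_in (t : R) x : 0 <= t <= 1 -> Omega x -> Omega (wscale d t%:C x).
Proof.
move=> /andP[t0 t1] Ox; apply: bO => //.
by rewrite cmodE cmod_real -[1](rmorph1 (real_complex R)) lecR ger0_norm.
Qed.

Lemma d_minkowskiE z : d_minkowski d Omega z =
  inf [set t : R | 0 < t /\ Omega (wscale d (t%:C)^-1 z)].
Proof.
congr inf; apply/seteqP; split=> t /= [t0 H]; split=> //; move: H;
  by congr Omega; apply/rowP => i; rewrite !mxE exprVn mulrC.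
Qed.

Lemma d_minkowski_le z t : 0 < t -> Omega (wscale d (t%:C)^-1 z) ->
  d_minkowski d Omega z <= t.
Proof.
by move=> t0 Ot; rewrite d_minkowskiE; apply: ge_inf => //; exists 0 => s [/ltW].
Qed.

Lemma d_minkowski_lt z r : d_minkowski d Omega z < r ->
  exists t x, [/\ 0 < t < r, Omega x & z = wscale d t%:C x].
Proof.
rewrite d_minkowskiE => H; apply: contrapT => nH.
have O0z : Omega (wscale d 0 z) by rewrite wscale0.
have [s s0 sP] := open_wscale oO O0z.
move: H; apply/negP; rewrite -leNgt; apply: lb_le_inf.
  (* A lower bound of the set bounds [inf] only if the set is inhabited: for large [t], the point
     [t^-d z] is close to 0, hence in [Omega]. *)
  exists (2 / s); split; first by rewrite divr_gt0.
  apply: sP; rewrite subr0 cmodV cmod_real gtr0_norm ?divr_gt0 //.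
  by rewrite invf_div; lra.
move=> t [t0 Ot]; rewrite leNgt; apply/negP => tr; apply: nH.
exists t, (wscale d (t%:C)^-1 z); split => //; first by rewrite t0.
by rewrite wscaleK // -cmod_gt0 cmod_real gtr0_norm.
Qed.

Hypotheses (conO : connected Omega) (hO : homogeneous Omega).

Lemma automorphism_pair_comp (f g f' g' : Cn -> Cn) :
  automorphism_pair Omega f g -> automorphism_pair Omega f' g' ->
  automorphism_pair Omega (f' \o f) (g \o g').
Proof.
move=> [[hf hg] fO gO gf fg] [[hf' hg'] f'O g'O g'f' f'g'].
split=> [|z Oz|z Oz|z Oz|z Oz] /=.
- by split; [exact: holomorphic_comp hf fO hf' | exact: holomorphic_comp hg' g'O hg].
- exact/f'O/fO.
- exact/gO/g'O.
- by rewrite g'f' ?gf //; exact: fO.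
- by rewrite fg ?f'g' //; exact: g'O.
Qed.

Lemma automorphism_pair_sym (f g : Cn -> Cn) :
  automorphism_pair Omega f g -> automorphism_pair Omega g f.
Proof. by move=> [[? ?] ? ? ? ?]; split. Qed.

(** Equicontinuity lets the identities [g k (f k z) = z] pass to the limit, so the limits [F] and
    [G] are inverse to each other and [g k \o F] tends to [G \o F], the identity. *)
Lemma automorphisms_near_identity (U : set_system nat) (a : nat -> Cn) :
  UltraFilter U -> (forall k, Omega (a k)) -> ulim U a 0 ->
  exists f g : nat -> Cn -> Cn, [/\ forall k, automorphism_pair Omega (f k) (g k),
    forall k, f k (a k) = 0 & forall z, Omega z -> ulim U (g ^~ z) z].
Proof.
move=> UU Oa a0; have PU : ProperFilter U := ultra_proper (F := U).
have /choice[fg fgP] k : exists fg : (Cn -> Cn) * (Cn -> Cn),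
    automorphism_pair Omega fg.1 fg.2 /\ fg.1 (a k) = 0.
  by have [f [g H]] := homogeneous_pair hO (Oa k) O0; exists (f, g).
pose f k := (fg k).1; pose g k := (fg k).2.
have fgA k : automorphism_pair Omega (f k) (g k) := (fgP k).1.
have fa k : f k (a k) = 0 := (fgP k).2.
have limE (h h' : nat -> Cn -> Cn) :
    (forall k, automorphism_pair Omega (h k) (h' k)) ->
    exists H : Cn -> Cn, forall z, Omega z -> ulim U (h ^~ z) (H z).
  move=> hA; have /choice[H HP] z : exists l, Omega z -> ulim U (h ^~ z) l.
    have [Oz|nOz] := pselect (Omega z); last by exists 0 => Oz; case: nOz.
    have [|l lP] := @ulim_row _ _ UU _ (h ^~ z) M; last by exists l.
    by move=> k; have [_ hO' _ _ _] := hA k; exact/OM/hO'.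
  by exists H.
have gfA k := automorphism_pair_sym (fgA k).
have [F FP] := limE _ _ fgA; have [G GP] := limE _ _ gfA.
have hol (h h' : nat -> Cn -> Cn) (hA : forall k,
    automorphism_pair Omega (h k) (h' k)) k : holomorphic_on Omega (h k).
  by have [[]] := hA k.
have inO (h h' : nat -> Cn -> Cn) (hA : forall k,
    automorphism_pair Omega (h k) (h' k)) k z : Omega z -> Omega (h k z).
  by have [_ hO' _ _ _ /hO'] := hA k.
have bd (h h' : nat -> Cn -> Cn) (hA : forall k,
    automorphism_pair Omega (h k) (h' k)) k z : Omega z -> rnorm (h k z) <= M.
  by move=> /(inO _ _ hA k)/OM.
(* [f k 0] is asymptotic to [f k (a k) = 0], while [g k 0 = a k] tends to 0. These two values inside
   [Omega] start the connectedness argument for [F] and [G]. *)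
have F0 : F 0 = 0.
  apply: (ulim_unique UU (FP 0 O0)).
  have H := ulim_equicontinuous UU oO (hol _ _ fgA) (bd _ _ fgA) O0 a0.
  apply: (ulim_near UU _ H).
  by under eq_fun do rewrite fa; exact: ulim_cst.
have G0 : G 0 = 0.
  apply: (ulim_unique UU (GP 0 O0)).
  have <- : a = g ^~ 0; last exact: a0.
  by apply/funext => k; rewrite -(fa k); have [_ _ _ ->] := fgA k.
have selfmap (h h' : nat -> Cn -> Cn) (H : Cn -> Cn) : (forall k,
    automorphism_pair Omega (h k) (h' k)) ->
    (forall z, Omega z -> ulim U (h ^~ z) (H z)) -> H 0 = 0 ->
    forall z, Omega z -> Omega (H z).
  move=> hA HP H0; have OH0 : Omega (H 0) by rewrite H0.
  exact: (ulim_self_map UU oO conO O0 hO OM (hol _ _ hA) (inO _ _ hA) HP O0 OH0).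
have FO := selfmap _ _ _ fgA FP F0; have GO := selfmap _ _ _ gfA GP G0.
have inv (h h' : nat -> Cn -> Cn) (H H' : Cn -> Cn) : (forall k,
    automorphism_pair Omega (h k) (h' k)) ->
    (forall z, Omega z -> ulim U (h ^~ z) (H z)) ->
    (forall z, Omega z -> ulim U (h' ^~ z) (H' z)) ->
    (forall z, Omega z -> Omega (H z)) -> forall z, Omega z -> H' (H z) = z.
  move=> hA HP H'P HO z Oz; have h'A k := automorphism_pair_sym (hA k).
  apply: (ulim_unique UU (H'P _ (HO z Oz))).
  have K := ulim_equicontinuous UU oO (hol _ _ h'A) (bd _ _ h'A) (HO z Oz) (HP z Oz).
  apply: (ulim_near UU _ K).
  have -> : (fun k => h' k (h k z)) = fun=> z; last exact: ulim_cst.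
  by apply/funext => k; have [_ _ _ ->] := hA k.
have GF := inv _ _ _ _ fgA FP GP FO; have FG := inv _ _ _ _ gfA GP FP GO.
have FGA : automorphism_pair Omega F G.
  split=> //; split.
    exact: (ulim_holomorphic UU oO (hol _ _ fgA) (bd _ _ fgA) FP).
  exact: (ulim_holomorphic UU oO (hol _ _ gfA) (bd _ _ gfA) GP).
exists (fun k => G \o f k), (fun k => g k \o F); split=> [k|k|z Oz].
- exact: automorphism_pair_comp (fgA k) (automorphism_pair_sym FGA).
- by rewrite /= fa G0.
- by rewrite -[X in ulim U _ X](GF z Oz); exact/GP/FO.
Qed.

(** Counterexamples [t_k^d x_k] along [a_k -> 0] would converge to [y = s^d l] with [l] in the
    closure of [Omega] and [s <= 1 - eps]. Both [y] and [(s + eps)^-d y] are then interior, and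
    [g_k] moves the counterexamples by amounts tending to 0, so it carries them into the required
    sublevels. *)
Lemma sublevel_automorphism eps : 0 < eps ->
  exists2 r, 0 < r & forall a, rnorm a < r -> exists f g : Cn -> Cn,
    [/\ automorphism_pair Omega f g, f a = 0 & forall s y, s <= 1 ->
      d_sublevel d Omega (s - eps) y ->
      Omega y /\ d_sublevel d Omega s (g y)].
Proof.
move=> e0; apply: contrapT => /forall2NP H.
have [U [UU HU]] := ultrafilter_nat_exists.
have PU : ProperFilter U := ultra_proper (F := U).
have [r0 r00 r0P] := (open_rnormP Omega).1 oO 0 O0.
(* Failure is recorded for all automorphism pairs, since the pairs near the identity are constructed
   only once the whole sequence [a] is known. *)
have /choice[a aP] k : exists a, [/\ rnorm a < 2^-1 ^+ k, Omega a &
    forall f g, automorphism_pair Omega f g -> f a = 0 ->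
    exists sy : R * Cn, [/\ sy.1 <= 1, d_minkowski d Omega sy.2 < sy.1 - eps &
      ~ (Omega sy.2 /\ d_minkowski d Omega (g sy.2) < sy.1)]].
  have [/negP|] := H (Num.min r0 (2^-1 ^+ k)).
    by rewrite lt_min r00 exprn_gt0 // invr_gt0.
  move=> /existsNP[a /not_implyP[]]; rewrite lt_min => /andP[ar ak] Ha.
  exists a; split=> // [|f g fg fa]; first by apply: r0P; rewrite subr0.
  apply: contrapT => nsy; apply: Ha; exists f, g; split=> // s y s1 sy.
  by apply: contrapT => ny; apply: nsy; exists (s, y).
have a0 : ulim U a 0.
  move=> e ep; apply: filterS (near_exprn_half_lt _ HU ep) => k.
  by rewrite subr0; apply: lt_trans; have [] := aP k.
have Oa k : Omega (a k) by have [] := aP k.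
have [f [g [fg fa gid]]] := automorphisms_near_identity UU Oa a0.
have /choice[sy syP] k : exists sy : R * Cn,
    [/\ sy.1 <= 1, d_minkowski d Omega sy.2 < sy.1 - eps &
      ~ (Omega sy.2 /\ d_minkowski d Omega (g k sy.2) < sy.1)].
  by have [_ _] := aP k; apply; [exact: fg | exact: fa].
have /choice[tx txP] k : exists tx : R * Cn, [/\ 0 < tx.1 < (sy k).1 - eps,
    Omega tx.2 & (sy k).2 = wscale d tx.1%:C tx.2].
  have [_ /d_minkowski_lt[t [x H']] _] := syP k.
  by exists (t, x).
pose t k := (tx k).1; pose x k := (tx k).2.
have t01 k : 0 < t k < 1 - eps.
  by have [/andP[h1 h2] _ _] := txP k; have [h3 _ _] := syP k; rewrite /t; lra.
have Ox k : Omega (x k) by have [] := txP k.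
have yE k : (sy k).2 = wscale d (t k)%:C (x k) by have [] := txP k.
have [l xl] := ulim_row UU (fun k => OM (Ox k)).
have [|s ts] := @ultra_real_cvg _ _ UU t 1.
  by move=> k; have := t01 k => /andP[h1 h2]; rewrite gtr0_norm //; lra.
have tsC : ulim U (fun k => (t k)%:C : R[i]) (s%:C : R[i]).
  move=> e ep; apply: filterS (ts e ep) => k.
  by rewrite -rmorphB -[rnorm _]/(cmod _) cmod_real.
have s0 : 0 <= s.
  apply/ler_addgt0Pr => e ep; have [k] := filter_ex (ts e ep).
  by rewrite ltr_norml; have := t01 k; lra.
have s1 : s <= 1 - eps.
  apply/ler_addgt0Pr => e ep; have [k] := filter_ex (ts e ep).
  by rewrite ltr_norml; have := t01 k; lra.
have cll e : 0 < e -> exists2 y, Omega y & rnorm (y - l) < e.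
  by move=> /xl/filter_ex[k h]; exists (x k).
have dcl r : 0 <= r < 1 -> Omega (wscale d r%:C l).
  exact: wscale_closure.
pose y := wscale d s%:C l.
have Oy : Omega y by apply: dcl; lra.
have yl : ulim U (fun k => (sy k).2) y.
  by under eq_fun do rewrite yE; exact: ulim_wscale.
have gy : ulim U (fun k => g k (sy k).2) y.
  have hg k : holomorphic_on Omega (g k) by have [[]] := fg k.
  have gM k z : Omega z -> rnorm (g k z) <= M.
    by move=> Oz; have [_ _ gO _ _] := fg k; exact/OM/gO.
  have := ulimD UU (gid y Oy) (ulim_equicontinuous UU oO hg gM Oy yl).
  by rewrite addr0; under eq_fun do rewrite addrC subrK.
(* The comparison radius [t k + eps] lies below the level [(sy k).1] and, unlike that level, has a
   known limit. *)
have tV : ulim U (fun k => ((t k + eps)%:C)^-1 : R[i]) ((s + eps)%:C)^-1.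
  apply: (@ulim_continuous _ _ UU _ _ (@GRing.inv R[i])).
    apply/differentiable_continuous/(@differentiableV _ _ id) => //.
    by rewrite -cmod_gt0 cmod_real gtr0_norm; lra.
  rewrite rmorphD; under eq_fun do rewrite rmorphD.
  by apply: ulimD => //; exact: ulim_cst.
have Oend : Omega (wscale d ((s + eps)%:C)^-1 y).
  rewrite /y wscaleM -fmorphV -rmorphM /=; apply: dcl.
  have se : 0 < s + eps by lra.
  rewrite mulrC divr_ge0 ?(ltW se) //= ltr_pdivrMr // mul1r; lra.
have [k Ok] := filter_ex (ulim_open UU oO Oend (ulim_wscale UU d tV gy)).
have [sy1 _ nsy] := syP k; have [/andP[tk1 tk2] _ _] := txP k.
apply: nsy; split.
  by rewrite yE; apply: wscale_in => //; have := t01 k; lra.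
apply: le_lt_trans (d_minkowski_le _ Ok) _; rewrite /t; lra.
Qed.

End NearIdentity.

(** * The squeezing function *)

Section Squeezing.
Context (R : realType) (n : nat).
Notation Cn := 'rV[R[i]]_n.
Variables (d : 'I_n -> nat) (Omega D : set Cn) (M MD : R).
Hypotheses (d0 : forall i, (0 < d i)%N) (oO : open Omega) (O0 : Omega 0)
  (OM : forall z, Omega z -> rnorm z <= M) (M0 : 0 < M)
  (cO : convex_in_Cn Omega) (bO : d_balanced d Omega)
  (oD : open D) (DM : forall z, D z -> rnorm z <= MD) (MD0 : 0 < MD).

Definition squeezing_radii (z : Cn) : set R :=
  [set r : R | 0 < r <= 1 /\ exists f, [/\ injective_holomorphic D Omega f,
     f z = 0 & d_sublevel d Omega r `<=` f @` D]].

Lemma rnorm_wscale_lel t (x : Cn) : cmod t <= 1 ->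
  rnorm (wscale d t x) <= cmod t * rnorm x.
Proof.
move=> t1; apply: rnorm_coord_le => [|i].
  by rewrite mulr_ge0 ?cmod_ge0 ?rnorm_ge0.
rewrite mxE cmodM ler_pM ?cmod_ge0 ?rnorm_coord //.
by rewrite cmodX -(prednK (d0 i)) exprS ler_piMr ?cmod_ge0 // exprn_ile1 ?cmod_ge0.
Qed.

(** The competitor is [w -> c (w - z)]. As [|w - z| <= 2 MD], the choice of [c] sends [D] into the
    [e]-ball; for [t < c r / (2 M)], points [t^d x] have norm below [c r], so their preimages lie
    within [r] of [z]. *)
Lemma squeezing_radii_nonempty z : D z -> squeezing_radii z !=set0.
Proof.
move=> Dz; have [e e0 eP] := (open_rnormP Omega).1 oO 0 O0.
have [r r0 rP] := (open_rnormP D).1 oD z Dz.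
pose c := e / (3 * MD); have c0 : 0 < c by rewrite divr_gt0 ?mulr_gt0.
have cC : c%:C != 0 :> R[i] by rewrite -cmod_gt0 cmod_real gtr0_norm.
exists (Num.min 1 (c * r / (2 * M))); split.
  apply/andP; split; last by rewrite ge_min lexx.
  by rewrite lt_min ltr01 divr_gt0 // mulr_gt0.
exists (fun w => c%:C *: (w - z)); split.
- split=> [w _|w Dw|w w' _ _].
  + apply: (@differentiableZ _ _ _ (fun w => w - z) c%:C w).
    exact: differentiableB.
  + apply: eP; rewrite subr0 rnormZ cmod_real gtr0_norm // /c.
    rewrite mulrAC ltr_pdivrMr ?mulr_gt0 // ltr_pM2l //.
    apply: le_lt_trans (ler_rnormB w z) _; move: (DM Dw) (DM Dz) MD0; lra.
  + by move=> /(scalerI cC)/addIr.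
- by rewrite subrr scaler0.
move=> y /(d_minkowski_lt d0 oO O0)[t [x [/andP[t0 tr] Ox ->]]].
move: tr; rewrite lt_min ltr_pdivlMr ?mulr_gt0 // => /andP[t1 tr].
exists (z + (c%:C)^-1 *: wscale d t%:C x); last first.
  by rewrite addrC addKr scalerA divff // scale1r.
apply: rP; rewrite addrC addKr rnormZ cmodV cmod_real gtr0_norm //.
rewrite mulrC ltr_pdivrMr //.
have tC : cmod (t%:C : R[i]) = t by rewrite cmod_real gtr0_norm.
have := @rnorm_wscale_lel t%:C x; rewrite tC => /(_ (ltW t1)).
have := OM Ox; have := rnorm_ge0 x; nra.
Qed.

Lemma squeezing_radii_ub z : ubound (squeezing_radii z) 1.
Proof. by move=> r [/andP[]]. Qed.

Lemma squeezing_ge z r : squeezing_radii z r -> r <= squeezing d Omega D z.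
Proof. by apply: ub_le_sup; exists 1; exact: squeezing_radii_ub. Qed.

Lemma squeezing_gt0_le1 z : D z -> 0 < squeezing d Omega D z <= 1.
Proof.
move=> /squeezing_radii_nonempty[r rz]; apply/andP; split.
  by apply: lt_le_trans (squeezing_ge rz); case: rz => /andP[].
by apply: ge_sup; [exists r | exact: squeezing_radii_ub].
Qed.

Hypotheses (conO : connected Omega) (hO : homogeneous Omega).

(** Both points vary near [z0], so exchanging them turns this one-sided bound into continuity. *)
Lemma squeezing_almost_le z0 eps : D z0 -> 0 < eps ->
  exists2 r, 0 < r & forall z w, rnorm (z - z0) < r -> rnorm (w - z0) < r ->
  squeezing d Omega D z - eps <= squeezing d Omega D w.
Proof.
move=> Dz0 e0.
have [r r0 rP] := sublevel_automorphism d0 oO O0 OM cO bO conO hO e0.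
have [s s0 sP] := holomorphic_lipschitz_near oD Dz0.
have [e e00 eP] := (open_rnormP D).1 oD z0 Dz0.
pose C := 16 * M / s; have C0 : 0 <= C by rewrite divr_ge0 ?mulr_ge0 // ltW.
(* The factor 2 accounts for [|w - z| < 2 del]; then the Lipschitz bound gives [|f w| < r]. *)
pose del := Num.min e (Num.min s (r / (2 * (C + 1)))).
exists del.
  by rewrite !lt_min e00 s0 divr_gt0 // mulr_gt0 // ltr_wpDl.
move=> z w; rewrite !lt_min => /and3P[/eP Dz zs zr] /and3P[/eP Dw ws wr].
rewrite lerBlDr; apply: ge_sup; first exact: squeezing_radii_nonempty.
move=> t [/andP[t0 t1] [f [[hf fO fI] fz ft]]]; rewrite -lerBlDr.
(* A nonpositive [t - eps] is not an admissible radius; positivity of the squeezing function settles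
   that case. *)
have [te|te] := leP (t - eps) 0.
  by apply: le_trans te (ltW _); have /andP[] := squeezing_gt0_le1 Dw.
have fw : rnorm (f w) < r.
  have fM y : D y -> rnorm (f y) <= M by move=> /fO/OM.
  have := sP f M hf fM z w zs ws; rewrite fz subr0 -/C => H.
  apply: le_lt_trans H _.
  move: zr wr; rewrite !ltr_pdivlMr ?mulr_gt0 ?ltr_wpDl //.
  have := ler_rdistD z0 w z; rewrite [rnorm (z0 - z)]rdistC.
  have := rnorm_ge0 (w - z); nra.
have [g [g' [[[hg hg'] gO g'O g'g gg'] gfw H]]] := rP _ fw.
apply: squeezing_ge; split; first by rewrite te; lra.
exists (g \o f); split=> //.
  split=> [y Dy|y Dy|y y' Dy Dy' /= E].
  - exact: (differentiable_comp (hf y Dy) (hg _ (fO y Dy))).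
  - exact/gO/fO.
  - apply: fI => //; rewrite -(g'g (f y)); last by apply: fO; rewrite inE in Dy.
    by rewrite E g'g //; apply: fO; rewrite inE in Dy'.
(* Surjectivity goes through the inverse: [g' y] lies in the [t]-sublevel, hence equals some [f x],
   and [y = g (g' y)] because [y] is in [Omega]. *)
move=> y /(H t y t1)[Oy /ft[x Dx fx]].
by exists x => //=; rewrite fx gg'.
Qed.

Lemma squeezing_continuous : {within D, continuous (squeezing d Omega D)}.
Proof.
apply: continuous_in_subspaceT => z0; rewrite inE => Dz0.
move=> A /nbhs_ballP[eps /= e0 epsA]; have e2 : 0 < eps / 2 by rewrite divr_gt0.
have [r r0 rP] := squeezing_almost_le Dz0 e2.
apply/nbhs_rnormP; exists r => // w wr; apply: epsA.
have z0r : rnorm (z0 - z0) < r by rewrite subrr rnorm0.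
rewrite -ball_normE /= ltr_norml; move: (rP _ _ z0r wr) (rP _ _ wr z0r) => h1 h2.
by apply/andP; split; lra.
Qed.

End Squeezing.

Theorem theorem4p9 (R : realType) (n : nat) (hn : (2 <= n)%N)
    (d : 'I_n -> nat) (hd : forall i, (0 < d i)%N)
    (Omega D : set 'rV[R[i]]_n)
    (Omega_domain : is_domain Omega) (Omega_bounded : bounded_set Omega)
    (Omega_convex : convex_in_Cn Omega)
    (Omega_homogeneous : homogeneous Omega)
    (Omega_balanced : d_balanced d Omega)
    (D_domain : is_domain D) (D_bounded : bounded_set D) :
  (forall z, D z -> 0 < squeezing d Omega D z <= 1) /\
  {within D, continuous (squeezing d Omega D)}.
Proof.
have [[x Ox] oO conO] := Omega_domain; have [_ oD _] := D_domain.
have [M M0 OM] := bounded_set_rnorm Omega_bounded.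
have [MD MD0 DM] := bounded_set_rnorm D_bounded.
have O0 : Omega 0.
  by rewrite -(wscale0 x hd); apply: Omega_balanced => //; rewrite normr0.
split=> [z Dz|].
  exact: (squeezing_gt0_le1 hd oO O0 OM M0 oD DM MD0 Dz).
exact: (squeezing_continuous hd oO O0 OM M0 Omega_convex Omega_balanced oD DM MD0
  conO Omega_homogeneous).
Qed.
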